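(* Let $n\ge 1$ be an integer and $T>0$. The TL-SympNet map $\tilde\varphi_t$ is a universal approximator within the set of affine time-dependent symplectic transformations. That is, for every open set $U\subset\mathbb{R}^{2n}$, every affine time-dependent symplectic map $\varphi:U\times[0,T]\to\mathbb{R}^{2n}$, every compact set $W\subset U$ and every $\varepsilon>0$, there exists a TL-SympNet $(\tilde\varphi_t)_{t\in[0,T]}$ (for some number of layers $N$, some width $l$, some sublayers and subwidth, and some choice of its learnable parameters) such that $$\sup_{t\in[0,T]}\ \sup_{\boldsymbol z\in W}\ \big\|\tilde\varphi_t(\boldsymbol z)-\varphi(\boldsymbol z,t)\big\|<\varepsilon .$$
   Context: Let $I_n$ be the $n\times n$ identity matrix and $J=\begin{pmatrix}0&I_n\\-I_n&0\end{pmatrix}\in\mathbb{R}^{2n\times 2n}$. **Time-dependent symplectic map.** For an open set $U\subset\mathbb{R}^{2n}$, a map $\varphi\in C^1(U\times[0,T];\mathbb{R}^{2n})$ is called time-dependent symplectic if for every fixed $t\in[0,T]$ the map $\varphi(\cdot,t)$ is symplectic, i.e. $\nabla_{\boldsymbol z}\varphi(\boldsymbol z,t)^{\top}J\,\nabla_{\boldsymbol z}\varphi(\boldsymbol z,t)=J$ for all $\boldsymbol z\in U$. It is called an affine time-dependent symplectic transformation if it is affine in $\boldsymbol z$. **TL-SympNet.** Let $N,l\ge 1$ be integers. For each $i\in\{1,\dots,N\}$ let $K^i\in\mathbb{R}^{l\times n}$ be a matrix, $\boldsymbol b^i\in\mathbb{R}^l$ a vector, and $\boldsymbol a^i:\mathbb{R}\to\mathbb{R}^l$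 a fully connected neural network, and put $$\tilde\sigma_{K^i,\boldsymbol a^i,\boldsymbol b^i}(\boldsymbol x;t)=(K^i)^{\top}\big(\boldsymbol a^i(t)\odot(K^i\boldsymbol x+\boldsymbol b^i)\big),\qquad \boldsymbol x\in\mathbb{R}^n,\ t\in[0,T],$$ where $\odot$ is the componentwise product. For $\boldsymbol x,\boldsymbol p\in\mathbb{R}^n$ define $$\mathcal{T}^{low,i}_t\begin{pmatrix}\boldsymbol x\\ \boldsymbol p\end{pmatrix}=\begin{pmatrix}\boldsymbol x\\ \boldsymbol p+\tilde\sigma_{K^i,\boldsymbol a^i,\boldsymbol b^i}(\boldsymbol x;t)\end{pmatrix},\qquad \mathcal{T}^{up,i}_t\begin{pmatrix}\boldsymbol x\\ \boldsymbol p\end{pmatrix}=\begin{pmatrix}\tilde\sigma_{K^i,\boldsymbol a^i,\boldsymbol b^i}(\boldsymbol p;t)+\boldsymbol x\\ \boldsymbol p\end{pmatrix}.$$ A TL-SympNet is an alternating composition of these maps, of one of the two forms $$\tilde\varphi_t=\mathcal{T}^{up,N}_t\circ\mathcal{T}^{low,N}_t\circ\cdots\circ\mathcal{T}^{up,1}_t\circ\mathcal{T}^{low,1}_t\quad\text{or}\quad \tilde\varphi_t=\mathcal{T}^{low,N}_t\circ\mathcal{T}^{up,N}_t\circ\cdots\circ\mathcal{T}^{low,1}_t\circ\mathcal{T}^{up,1}_t .$$ The learnable parameters are those of the matrices $K^i$, the vectors $\boldsymbol b^i$ and the fully connected neural networks $\boldsymbol a^i$, $i=1,\dots,N$. The positive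 integer $l$, which can be tuned, is called the width, $N$ is the number of layers, and the number of layers and the width of each network $\boldsymbol a^i$ are called the sublayers and the subwidth of the TL-SympNet.
   Formalization: The low and up maps of each layer have independent parameters K, a, b (with shared ones, as written, the claim fails, e.g. for the constant map z ↦ Jz), and the unspecified activation of the fully connected networks is taken to be any fixed continuous non-polynomial function. *)

(* Defs.v *)
From mathcomp Require Import all_boot all_order all_algebra.
From mathcomp Require Import all_classical all_reals all_analysis.

Set Implicit Arguments.
Unset Strict Implicit.
Unset Printing Implicit Defensive.

Import Order.TTheory GRing.Theory Num.Theory.
Import numFieldNormedType.Exports.

Local Open Scope classical_set_scope.
Local Open Scope ring_scope.

(* Points of R^(2n) are columns z = col_mx x p with x, p : 'cV_n. *)

Definition symplJ (R : realType) (n : nat) : 'M[R]_(n + n) :=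
  block_mx 0 1%:M (- 1%:M) 0.

(* The library norm on matrices is the sup norm; this is the Euclidean one. *)
Definition enorm (R : realType) (m : nat) (v : 'cV[R]_m) : R :=
  Num.sqrt (\sum_(i < m) v i 0 ^+ 2).

(* The library's [jacobian] is for row vectors and acts on the right, so it is
   the transpose of the matrix of partial derivatives used here. *)
Definition grad (R : realType) (m k : nat) (f : 'cV[R]_m -> 'cV[R]_k)
    (z : 'cV[R]_m) : 'M[R]_(k, m) :=
  \matrix_(i, j) ('D_(delta_mx j 0) f z) i 0.

(* C^1 on a set S which need not be open (here S = U x [0, T]): f has at every
   point of S a Frechet derivative relative to S, continuous on S.  At interior
   points this is the ordinary derivative, at t = 0 and t = T it is one-sided
   in t.  In finite dimension, continuity of [Df] in operator norm amounts to
   continuity of [Df p v] in p for every v.  Values of f off S are ignored. *)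
Definition C1_on (R : realType) (V W : normedModType R) (S : set V)
    (f : V -> W) : Prop :=
  exists Df : V -> {linear V -> W},
    (forall p, S p -> forall e : R, 0 < e ->
       \forall q \near within S (nbhs p),
         `|f q - f p - Df p (q - p)| <= e * `|q - p|) /\
    (forall v, {within S, continuous (fun p => Df p v)}).

Definition symplectic_on (R : realType) (n : nat) (U : set 'cV[R]_(n + n))
    (f : 'cV[R]_(n + n) -> 'cV[R]_(n + n)) : Prop :=
  forall z, U z -> (grad f z)^T *m symplJ R n *m grad f z = symplJ R n.

Definition affine_on (R : realType) (m k : nat) (U : set 'cV[R]_m)
    (f : 'cV[R]_m -> 'cV[R]_k) : Prop :=
  exists (A : 'M[R]_(k, m)) (c : 'cV[R]_k), forall z, U z -> f z = A *m z + c.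

Definition time_dependent_symplectic (R : realType) (n : nat) (T : R)
    (U : set 'cV[R]_(n + n))
    (phi : 'cV[R]_(n + n) -> R -> 'cV[R]_(n + n)) : Prop :=
  C1_on (U `*` `[0, T]) (fun zt : 'cV[R]_(n + n) * R => phi zt.1 zt.2) /\
  (forall t, t \in `[0, T] -> symplectic_on U (phi ^~ t)).

Definition affine_time_dependent_symplectic (R : realType) (n : nat) (T : R)
    (U : set 'cV[R]_(n + n))
    (phi : 'cV[R]_(n + n) -> R -> 'cV[R]_(n + n)) : Prop :=
  time_dependent_symplectic T U phi /\
  (forall t, t \in `[0, T] -> affine_on U (phi ^~ t)).

(* Fully connected networks R -> R^l with L.+1 hidden layers of width m: the
   activation acts componentwise after each hidden layer and is not applied to
   the output. *)
Record fcnn (R : realType) (L m l : nat) := Fcnn {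
  fcnn_in : 'cV[R]_m * 'cV[R]_m;
  fcnn_hidden : L.-tuple ('M[R]_m * 'cV[R]_m);
  fcnn_out : 'M[R]_(l, m) * 'cV[R]_l }.

Definition fcnn_eval (R : realType) (act : R -> R) (L m l : nat)
    (a : fcnn R L m l) (t : R) : 'cV[R]_l :=
  let y0 := map_mx act (t *: (fcnn_in a).1 + (fcnn_in a).2) in
  let y := foldl (fun y (Wb : 'M[R]_m * 'cV[R]_m) =>
                    map_mx act (Wb.1 *m y + Wb.2)) y0 (fcnn_hidden a) in
  (fcnn_out a).1 *m y + (fcnn_out a).2.

Record tl_unit (R : realType) (n l L m : nat) := TLUnit {
  tl_K : 'M[R]_(l, n);
  tl_a : fcnn R L m l;
  tl_b : 'cV[R]_l }.

Section TLSympNet.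
Context (R : realType) (act : R -> R) (n l L m : nat).
Implicit Types (u : tl_unit R n l L m) (t : R) (z : 'cV[R]_(n + n)).

Definition tl_sigma u (x : 'cV[R]_n) t : 'cV[R]_n :=
  (tl_K u)^T *m map2_mx *%R (fcnn_eval act (tl_a u) t) (tl_K u *m x + tl_b u).

Definition tl_low u t z : 'cV[R]_(n + n) :=
  col_mx (usubmx z) (dsubmx z + tl_sigma u (usubmx z) t).

Definition tl_up u t z : 'cV[R]_(n + n) :=
  col_mx (tl_sigma u (dsubmx z) t + usubmx z) (dsubmx z).

(* A layer is a pair (parameters of its low unit, parameters of its up unit);
   the first layer of the sequence acts first.  The two units of a layer do not
   share parameters.  Were they equal, with n = 1 every linear part of an
   up-low net would map the cone |p| <= x into itself (and of a low-up net the
   cone |x| <= p), so a quarter turn could not be approximated. *)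
Definition tl_net_up_low N
    (theta : N.-tuple (tl_unit R n l L m * tl_unit R n l L m)) t z :=
  foldl (fun y th => tl_up th.2 t (tl_low th.1 t y)) z theta.

Definition tl_net_low_up N
    (theta : N.-tuple (tl_unit R n l L m * tl_unit R n l L m)) t z :=
  foldl (fun y th => tl_low th.1 t (tl_up th.2 t y)) z theta.

End TLSympNet.

(* N layers, width l, subwidth m; the sublayer count is given by L. *)
Definition is_tl_sympnet (R : realType) (act : R -> R) (n : nat)
    (psi : R -> 'cV[R]_(n + n) -> 'cV[R]_(n + n)) : Prop :=
  exists (N l L m : nat)
         (theta : N.-tuple (tl_unit R n l L m * tl_unit R n l L m)),
    [/\ (0 < N)%N, (0 < l)%N, (0 < m)%N &
        psi = tl_net_up_low act theta \/ psi = tl_net_low_up act theta].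

(* The activation of the networks a^i is unspecified; this is the usual class
   for which fully connected networks are universal.  Some condition is needed:
   for a constant activation the nets do not depend on t. *)
Definition admissible_activation (R : realType) (act : R -> R) : Prop :=
  continuous act /\ ~ (exists p : {poly R}, forall x, act x = p.[x]).

(* Main.v *)
Require Import Defs.
From mathcomp Require Import all_boot all_order all_algebra.
From mathcomp Require Import all_classical all_reals all_analysis.
From mathcomp Require Import perm ring lra.

Import Order.TTheory GRing.Theory Num.Theory.
Import numFieldNormedType.Exports.

Local Open Scope classical_set_scope.
Local Open Scope ring_scope.

(** On a nonempty open set an affine symplectic map determines its linear part
    and its translation part, so the given family is
    [z |-> A t *m z + c t] with [A t] symplectic and [A], [c] continuous in [t]
    ([affine_symplectic_coefficients]).  Two independent facts remain.

    The first is about networks of one real variable: if the activation is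
    continuous and not a polynomial, the span of the functions
    [t |-> act (w * t + b)] is uniformly dense in the continuous functions on
    [0, T] ([universal_approximation]).  If [t ^+ j * tau (w * t + b)] is a
    limit of such sums for all [w] and [b], then so is
    [t ^+ j.+1 * (tau (w * t + b + h) - tau (w * t + b))]: Riemann sums give
    increments of an antiderivative of [tau], and a difference quotient in [w]
    brings out the factor [t].  Starting from the activation, this yields
    [t ^+ k] times any iterated difference of order [k], hence every power of
    [t], since a continuous function all of whose differences of some order
    vanish is a polynomial ([poly_of_mdiff0]).  The Weierstrass theorem, proved
    with Bernstein operators, concludes.

    The second is about matrices: a continuous path of symplectic matrices is a
    finite product of continuous paths of symmetric shears
    ([realizable_symplectic]).  A symplectic matrix with invertible upper left
    block [P] is a lower shear times [diag(P, P^-T)] times an upper shear, and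
    [diag(P, P^-T)] is a product of shears as soon as [P] is a product of
    symmetric invertible matrices.  Gaussian elimination provides such a
    factorization of [P], continuously in time when the quadratic form of [P]
    is positive ([sym_product_pos]) and with pivoting when [P] is constant
    ([sym_product_cst]).  The initial value [A 0] becomes of this kind after one
    shear ([symplectic_unit_pencil]); the rest of the path is a product of paths
    near the identity, obtained by cutting [0, T] into short intervals.

    A symmetric matrix is a combination of rank one squares and shears of the
    same kind add up under composition, so width 1 suffices: each unit carries a
    rank one shear whose coefficient is a shallow network.  Translations are
    pairs of rank one shears with opposite coefficients and different biases.
    Uniform approximation on bounded sets is stable under composition because
    all the maps are Lipschitz, uniformly in time ([realizable_comp]). *)

Set Implicit Arguments.
Unset Strict Implicit.
Unset Printing Implicit Defensive.

(** * Uniform continuity and antiderivatives *)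

(** Heine's theorem on [a, b], for all small enough moduli [d], so that finitely
    many functions can share one. *)
Lemma heine (R : realType) (f : R -> R) (a b e : R) : continuous f -> 0 < e ->
  \forall d \near 0^'+, forall x y, a <= x <= b -> `|y - x| <= d ->
    `|f y - f x| <= e.
Proof.
move=> cf e0.
have nc := (compact_near_coveringP _).1 (@segment_compact R a b).
suff /nc : forall x, `[a, b]%classic x -> \forall x' \near x & d \near 0^'+,
    forall y, `|y - x'| <= d -> `|f y - f x'| <= e.
  apply: filterS => d dP x y xab.
  by apply: dP => /=; rewrite in_itv.
move=> x _.
have /cvgrPdist_le /(_ (e / 2)) := cf x.
rewrite divr_gt0 // => /(_ isT) /nbhs_ballP[r /= r0 rP].
have {}rP y : `|x - y| < r -> `|f x - f y| <= e / 2.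
  by move=> xy; apply: rP; rewrite -ball_normE.
have r2 : 0 < r / 2 by rewrite divr_gt0.
have key (x' d y : R) : d < r / 2 -> `|y - x'| <= d -> `|x - x'| < r / 2 ->
    `|f y - f x'| <= e.
  move=> dr yx' xx'.
  have h1 : `|f x - f x'| <= e / 2 by apply: rP; lra.
  have h2 : `|f x - f y| <= e / 2.
    by apply: rP; have := ler_distD x' x y; rewrite (distrC x' y); lra.
  by have := ler_distD (f x) (f y) (f x'); rewrite (distrC (f y) (f x)); lra.
exists (ball x (r / 2), [set d | d < r / 2]) => /=.
  by split; [exact: nbhsx_ballx|exact: nbhs_right_lt].
move=> [x' d] /= [xx' dr] y yx'; exact: (key _ d).
Qed.

(** Every continuous function has, on every bounded interval, an antiderivative
    whose difference quotients converge uniformly. *)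
Lemma unif_antiderivative (R : realType) (f : R -> R) (B : R) : continuous f ->
  exists G : R -> R, forall e, 0 < e ->
    exists2 d, 0 < d & forall x y, `|x| <= B -> `|y| <= B -> `|y - x| <= d ->
    `|G y - G x - (y - x) * f x| <= e * `|y - x|.
Proof.
move=> cf.
pose a := - B - 1; pose u := B + 1.
pose G x := (\int[lebesgue_measure]_(t in `[a, x]) f t)%R.
have dG x : a < x -> x < u -> is_derive x 1 G (f x).
  move=> ax xu.
  have fi : lebesgue_measure.-integrable `[a, u] (EFin \o f).
    apply: continuous_compact_integrable; first exact: segment_compact.
    exact: continuous_subspaceT.
  have [dG <-] := continuous_FTC1_closed xu fi ax (cf x).
  by rewrite derive1E; exact: derivableP.
exists G => e e0.
have [d [d0 hd]] :=
  filter_ex (filterI (nbhs_right_gt 0) (@heine R f (- B) B e cf e0)).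
exists d => //.
have main x y : `|x| <= B -> `|y| <= B -> x <= y -> exists2 c, x <= c <= y &
    G y - G x = f c * (y - x).
  rewrite !ler_norml => /andP[x1 x2] /andP[y1 y2] xy.
  have dGxy z : x <= z <= y -> is_derive z 1 G (f z).
    by move=> /andP[? ?]; apply: dG; rewrite /a /u; lra.
  have [z|z|c] := @MVT_segment R G f x y xy.
  - by rewrite in_itv /= => /andP[? ?]; apply: dGxy; rewrite !ltW.
  - apply: continuous_in_subspaceT => t; rewrite inE /= in_itv /= => txy.
    have dGt := dGxy t txy.
    by apply: differentiable_continuous; apply/derivable1_diffP; apply: ex_derive.
  - by rewrite in_itv /= => cxy E; exists c.
move=> x y xB yB yx.
suff [c cx E] : exists2 c, `|c - x| <= `|y - x| & G y - G x = f c * (y - x).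
  rewrite E [(y - x) * _]mulrC -mulrBl normrM ler_wpM2r //.
  apply: hd; first by rewrite -ler_norml.
  exact: le_trans yx.
case: (leP x y) => xy.
  have [c /andP[c1 c2] E] := main x y xB yB xy; exists c => //.
  by rewrite !ger0_norm; lra.
have [c /andP[c1 c2] E] := main y x yB xB (ltW xy); exists c.
  by rewrite !ler0_norm; lra.
by rewrite -opprB E -mulrN opprB.
Qed.

(** * Sums of activations dense in the continuous functions *)

(** The output of a network with one input, one hidden layer and a linear output:
    a neuron is a triple (output weight, inner weight, bias). *)
Definition net_sum (R : realType) (act : R -> R) (s : seq (R * R * R)) (t : R) :=
  \sum_(x <- s) x.1.1 * act (x.1.2 * t + x.2).

(** Uniform approximability on [0, T] by such networks. *)
Definition approximable (R : realType) (act : R -> R) (T : R) (f : R -> R) :=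
  forall e, 0 < e -> exists s, forall t, 0 <= t <= T ->
    `|f t - net_sum act s t| <= e.

Section Approximable.
Context (R : realType) (act : R -> R) (T : R).
Implicit Types f g tau : R -> R.
Local Notation apx := (approximable act T).

Lemma approximable_lim f :
  (forall e, 0 < e -> exists2 g, apx g &
     forall t, 0 <= t <= T -> `|f t - g t| <= e) -> apx f.
Proof.
move=> H e e0; have e2 : 0 < e / 2 by rewrite divr_gt0.
have [g /(_ _ e2)[s sP] fg] := H _ e2.
exists s => t tT; have := ler_distD (g t) (f t) (net_sum act s t).
by have := sP t tT; have := fg t tT; lra.
Qed.

Lemma approximable_unit w b : apx (fun t => act (w * t + b)).
Proof.
move=> e e0; exists [:: (1, w, b)] => t _.
by rewrite /net_sum big_seq1 /= mul1r subrr normr0 ltW.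
Qed.

Lemma approximable0 : apx (fun=> 0).
Proof.
by move=> e e0; exists [::] => t _; rewrite /net_sum big_nil subrr normr0 ltW.
Qed.

Lemma approximableD f g : apx f -> apx g -> apx (fun t => f t + g t).
Proof.
move=> af ag e e0; have e2 : 0 < e / 2 by rewrite divr_gt0.
have [s sP] := af _ e2; have [s' sP'] := ag _ e2.
exists (s ++ s') => t tT; rewrite {1}/net_sum big_cat /= -!/(net_sum _ _ _).
rewrite opprD addrACA (splitr e); apply: le_trans (ler_normD _ _) _.
by rewrite lerD ?sP ?sP'.
Qed.

Lemma approximableZ c f : apx f -> apx (fun t => c * f t).
Proof.
move=> af e e0; have c0 : 0 < `|c| + 1 by rewrite ltr_wpDl.
have [s sP] := af (e / (`|c| + 1)) (divr_gt0 e0 c0).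
exists [seq (c * x.1.1, x.1.2, x.2) | x <- s] => t tT.
rewrite /net_sum big_map /=.
under eq_bigr do rewrite -mulrA.
rewrite -mulr_sumr -mulrBr normrM.
apply: (@le_trans _ _ (`|c| * (e / (`|c| + 1)))).
  by rewrite ler_wpM2l // sP.
by rewrite mulrCA ler_piMr ?ltW // ltr_pdivrMr // mul1r ltrDl.
Qed.

Lemma approximable_sum (I : Type) (r : seq I) (F : I -> R -> R) :
  (forall i, apx (F i)) -> apx (fun t => \sum_(i <- r) F i t).
Proof.
move=> aF; elim: r => [|i r IH].
  by move=> e e0; have [s sP] := approximable0 e0;
    exists s => t tT; rewrite big_nil sP.
move=> e e0; have [s sP] := approximableD (aF i) IH e0.
by exists s => t tT; rewrite big_cons sP.
Qed.

(** Differentiating in the inner weight at the expense of one finite difference: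
    multiplication by [t] is the derivative of [w |-> G (w * t + b)], and only
    differences [G (x + h) - G x] of an antiderivative are limits of Riemann
    sums of [tau]. *)
Lemma approximable_step (j : nat) tau (h : R) : 0 <= T -> continuous tau ->
  (forall w b, apx (fun t => t ^+ j * tau (w * t + b))) ->
  forall w b, apx (fun t => t ^+ j.+1 * (tau (w * t + b + h) - tau (w * t + b))).
Proof.
move=> T0 ctau atau w b.
pose B := (`|w| + 1) * T + `|b| + `|h|.
have [G GP] := unif_antiderivative B ctau.
have Bx w' t y : `|w'| <= `|w| + 1 -> 0 <= t <= T -> `|y| <= `|h| ->
    `|w' * t + b + y| <= B.
  move=> hw /andP[t0 tT] hy; rewrite /B.
  apply: le_trans (ler_normD _ _) _; rewrite lerD //.
  apply: le_trans (ler_normD _ _) _; rewrite lerD // normrM (ger0_norm t0).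
  by rewrite ler_pM.
have TX k t : 0 <= t <= T -> 0 <= t ^+ k <= T ^+ k.
  by move=> /andP[t0 tT]; rewrite exprn_ge0 //= lerXn2r // nnegrE.
have aG w' : `|w'| <= `|w| + 1 ->
    apx (fun t => t ^+ j * (G (w' * t + b + h) - G (w' * t + b))).
  move=> hw; apply: approximable_lim => e e0.
  have C0 : 0 < T ^+ j * `|h| + 1 by rewrite ltr_wpDl // mulr_ge0 // exprn_ge0.
  pose e' := e / (T ^+ j * `|h| + 1).
  have e'0 : 0 < e' by rewrite divr_gt0.
  have [d d0 dP] := GP e' e'0.
  pose N := (Num.truncn (`|h| / d)).+1; pose del := h / N%:R.
  have N0 : 0 < N%:R :> R by rewrite ltr0n.
  have Ndel : N%:R * del = h by rewrite /del mulrC divfK // gt_eqF.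
  have del_d : `|del| <= d.
    rewrite /del normrM normfV (ger0_norm (ltW N0)) ler_pdivrMr // mulrC.
    by rewrite -ler_pdivrMr // ltW // truncnS_gt.
  have ih (i : nat) : (i <= N)%N -> `|i%:R * del| <= `|h|.
    move=> iN; rewrite -Ndel !normrM ler_wpM2r // !normr_nat.
    by rewrite ler_nat.
  exists (fun t => \sum_(i <- iota 0 N)
      del * (t ^+ j * tau (w' * t + (b + i%:R * del)))).
    by apply: approximable_sum => i; apply: approximableZ.
  move=> t tT; set x := w' * t + b.
  pose F i := G (x + i%:R * del).
  have -> : G (x + h) - G x = \sum_(i <- iota 0 N) (F i.+1 - F i).
    have := telescope_sumr F (leq0n N); rewrite /index_iota subn0 => ->.
    by rewrite /F Ndel mul0r addr0.
  rewrite mulr_sumr -sumrB.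
  apply: le_trans (ler_norm_sum _ _ _) _.
  apply: (@le_trans _ _ (\sum_(i <- iota 0 N) T ^+ j * (e' * `|del|))).
    rewrite big_seq [leRHS]big_seq; apply: ler_sum => i.
    rewrite mem_iota /= add0n => iN.
    rewrite [del * _]mulrCA -mulrBr normrM.
    have /andP[tj0 tjT] := TX j t tT.
    rewrite ger0_norm // ler_pM //.
    have Exi : x + i.+1%:R * del - (x + i%:R * del) = del.
      by rewrite -natr1; ring.
    have := dP (x + i%:R * del) (x + i.+1%:R * del).
    rewrite Exi /F /x -!addrA; apply => //.
    - by rewrite addrA; apply: Bx => //; apply: ih; rewrite ltnW.
    - by rewrite addrA; apply: Bx => //; apply: ih.
  rewrite -mulr_sumr big_const_seq count_predT size_iota iter_addr addr0.
  rewrite -mulrnAr -[`|del| *+ N]mulr_natl -[N%:R]normr_nat -normrM Ndel.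
  rewrite mulrCA /e' mulrAC ler_pdivrMr // ler_wpM2l ?ltW //.
  by rewrite ltrDl.
apply: approximable_lim => e e0.
have C0 : 0 < 2 * (T ^+ j.+1 + 1).
  by rewrite mulr_gt0 // ltr_wpDl // exprn_ge0.
pose e' := e / (2 * (T ^+ j.+1 + 1)).
have e'0 : 0 < e' by rewrite divr_gt0.
have [d d0 dP] := GP e' e'0.
have T1 : 0 < T + 1 by rewrite ltr_wpDl.
pose eta := Num.min 1 (d / (T + 1)).
have eta0 : 0 < eta by rewrite lt_min ltr01 divr_gt0.
have eta1 : eta <= 1 by rewrite ge_min lexx.
have etad : eta * T <= d.
  apply: (@le_trans _ _ (d / (T + 1) * T)).
    by rewrite ler_wpM2r // ge_min lexx orbT.
  by rewrite mulrAC ler_pdivrMr // ler_wpM2l ?ltW // ltrDl.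
pose gw w' t := t ^+ j * (G (w' * t + b + h) - G (w' * t + b)).
exists (fun t => eta^-1 * (gw (w + eta) t + (-1) * gw w t)).
  apply: approximableZ; apply: approximableD.
    apply: aG; apply: le_trans (ler_normD _ _) _.
    by rewrite lerD // gtr0_norm.
  by apply: approximableZ; apply: aG; rewrite lerDl.
move=> t tT; have /andP[t0 tT'] := tT; set x := w * t + b.
have Ex : (w + eta) * t + b = x + eta * t by rewrite /x; ring.
have etat0 : 0 <= eta * t by rewrite mulr_ge0 // ltW.
have P y : `|y| <= `|h| ->
    `|G (x + y + eta * t) - G (x + y) - eta * t * tau (x + y)| <= e' * (eta * t).
  move=> hy; have := dP (x + y) (x + y + eta * t).
  have -> : x + y + eta * t - (x + y) = eta * t by ring.
  rewrite (ger0_norm etat0); apply.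
  - by apply: Bx => //; rewrite lerDl.
  - rewrite addrAC -Ex; apply: Bx => //; apply: le_trans (ler_normD _ _) _.
    by rewrite lerD // gtr0_norm.
  - by apply: le_trans etad; rewrite ler_wpM2l // ltW.
have P1 := P h (lexx _).
have P0 : `|G (x + eta * t) - G x - eta * t * tau x| <= e' * (eta * t).
  by have := P 0; rewrite normr0 addr0; apply.
rewrite /gw Ex -/x (addrAC x _ h).
set a1 := G (x + h + _) - _ - _ in P1; set a0 := _ - _ - _ in P0.
have -> : t ^+ j.+1 * (tau (x + h) - tau x) - eta^-1 * (
    t ^+ j * (G (x + h + eta * t) - G (x + eta * t)) +
    -1 * (t ^+ j * (G (x + h) - G x))) = eta^-1 * t ^+ j * (a0 - a1).
  by rewrite /a0 /a1 exprS; field; rewrite gt_eqF.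
rewrite normrM ger0_norm; last by rewrite mulr_ge0 // ?exprn_ge0 // invr_ge0 ltW.
apply: (@le_trans _ _ (eta^-1 * t ^+ j * (2 * (e' * (eta * t))))).
  rewrite ler_wpM2l //; first by rewrite mulr_ge0 // ?exprn_ge0 // invr_ge0 ltW.
  by apply: le_trans (ler_normB _ _) _; lra.
have -> : eta^-1 * t ^+ j * (2 * (e' * (eta * t))) = e' * (2 * t ^+ j.+1).
  by rewrite exprS; field; rewrite gt_eqF.
rewrite /e' mulrAC ler_pdivrMr //; apply: ler_wpM2l; first exact: ltW.
by have /andP[_] := TX j.+1 t tT; lra.
Qed.

End Approximable.

(** Iterated finite differences with independent steps. *)
Fixpoint mdiff (R : realType) (hs : seq R) (f : R -> R) (x : R) : R :=
  if hs is h :: hs' then mdiff hs' f (x + h) - mdiff hs' f x else f x.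

Lemma mdiff_cons (R : realType) (h : R) hs f x :
  mdiff (h :: hs) f x = mdiff hs (fun y => f (y + h) - f y) x.
Proof.
elim: hs x => [//|k hs IH] x.
rewrite [RHS]/= -!IH /= (addrAC x k h); ring.
Qed.

Lemma continuous_shift_diff (R : realType) (f : R -> R) (h : R) :
  continuous f -> continuous (fun y => f (y + h) - f y).
Proof.
move=> cf x; apply: cvgB; last exact: cf.
apply: (@continuous_comp _ _ _ (fun y => y + h)); last exact: cf.
by apply: cvgD; [exact: cvg_id|exact: cvg_cst].
Qed.

Lemma continuous_mdiff (R : realType) (hs : seq R) (f : R -> R) :
  continuous f -> continuous (mdiff hs f).
Proof.
move=> cf; elim: hs => [//|h hs IH].
change (continuous (fun y => mdiff hs f (y + h) - mdiff hs f y)).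
exact: continuous_shift_diff.
Qed.

Lemma approximable_mdiff (R : realType) (act : R -> R) (T : R) hs w b :
  0 <= T -> continuous act ->
  approximable act T (fun t => t ^+ size hs * mdiff hs act (w * t + b)).
Proof.
move=> T0 cact; elim: hs w b => [|h hs IH] w b /=; last first.
  exact: (approximable_step h T0 (continuous_mdiff cact) IH).
apply: approximable_lim => e e0; exists (fun t => act (w * t + b)).
  exact: approximable_unit.
by move=> t _; rewrite mul1r subrr normr0 ltW.
Qed.

Lemma poly0_of_nat_roots (R : realType) (p : {poly R}) :
  (forall n : nat, p.[n%:R] = 0) -> p = 0.
Proof.
move=> p0; pose s := [seq i%:R : R | i <- iota 0 (size p)].
apply: (@roots_geq_poly_eq0 _ _ s).
- by apply/allP => _ /mapP[i _ ->]; apply/rootP.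
- by rewrite map_inj_uniq ?iota_uniq // => i j /eqP; rewrite eqr_nat => /eqP.
- by rewrite size_map size_iota.
Qed.

(** The difference operator sends ['X^(d.+1)] to a polynomial of degree [d] with
    leading coefficient [d.+1], so [p] can be reduced degree by degree. *)
Lemma poly_difference_equation (R : realType) (p : {poly R}) :
  exists q : {poly R}, forall x, q.[x + 1] - q.[x] = p.[x].
Proof.
have [d] := ubnP (size p); elim: d p => // d IH p.
rewrite ltnS leq_eqVlt => /orP[/eqP sp|/IH //].
case: d IH sp => [|d] IH sp.
  move/size_poly_leq0P: (eq_leq sp) => ->.
  by exists 0 => x; rewrite !horner0 subr0.
pose D : {poly R} := \sum_(i < d.+1) 'C(d.+1, i)%:R *: 'X^i.
have DE x : D.[x] = (x + 1) ^+ d.+1 - x ^+ d.+1.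
  rewrite exprD1n big_ord_recr /= binn mulr1n addrK /D horner_sum.
  by apply: eq_bigr => i _; rewrite !hornerE mulr_natl.
pose c := p`_d / d.+1%:R.
have [|q qE] := IH (p - c *: D).
  rewrite ltnS; apply/leq_sizeP => j; rewrite leq_eqVlt => /orP[/eqP <-|dj].
    rewrite coefB coefZ coef_sum (bigD1 ord_max) //= coefZ coefXn eqxx.
    rewrite big1 => [|i ne]; last first.
      rewrite coefZ coefXn; case: eqP => [E|_]; last by rewrite mulr0.
      by case/eqP: ne; apply: val_inj.
    by rewrite addr0 /= binSn mulr1 /c divfK ?subrr // pnatr_eq0.
  rewrite coefB coefZ (leq_sizeP _ _ (eq_leq sp)) // sub0r coef_sum.
  rewrite big1 ?mulr0 ?oppr0 //.
  move=> i _; rewrite coefZ coefXn; case: eqP => [E|_]; last by rewrite mulr0.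
  by move: dj; rewrite E ltnNge -ltnS ltn_ord.
exists (q + c *: 'X^(d.+1)) => x; move: (qE x).
rewrite !hornerE DE => E.
rewrite -[p.[x]](subrK (c * ((x + 1) ^+ d.+1 - x ^+ d.+1))).
by rewrite -E; ring.
Qed.

(** A continuous function killed by all differences of a fixed order is a
    polynomial.  By induction its first differences are polynomials; removing a
    polynomial solution of the difference equation of step 1 leaves a 1-periodic
    function whose first differences are periodic polynomials, hence constants,
    and they vanish because the function is bounded. *)
Lemma poly_of_mdiff0 (R : realType) (k : nat) (f : R -> R) : continuous f ->
  (forall hs, size hs = k -> forall x, mdiff hs f x = 0) ->
  exists p : {poly R}, forall x, f x = p.[x].
Proof.
elim: k f => [|k IH] f cf f0.
  by exists 0 => x; rewrite horner0; apply: (f0 [::]).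
have pol h : exists p : {poly R}, forall x, f (x + h) - f x = p.[x].
  apply: (IH (fun x => f (x + h) - f x)); first exact: continuous_shift_diff.
  by move=> hs sz x; rewrite -mdiff_cons; apply: f0; rewrite /= sz.
have [p1 p1E] := pol 1; have [q qE] := poly_difference_equation p1.
pose r x := f x - q.[x].
have cr : continuous r.
  by move=> x; apply: cvgB; [exact: cf|exact: continuous_horner].
have r1 x : r (x + 1) = r x.
  apply/eqP; rewrite -subr_eq0 /r.
  have -> : f (x + 1) - q.[x + 1] - (f x - q.[x]) =
    (f (x + 1) - f x) - (q.[x + 1] - q.[x]) by ring.
  by rewrite p1E qE subrr.
have rn x (n : nat) : r (x + n%:R) = r x.
  by elim: n => [|n IHn]; rewrite ?addr0 // -natr1 addrA r1.
have [C rC] : exists C : R, forall y : R, 0 <= y -> `|r y| <= C.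
  have cr01 : {within `[0, 1], continuous (fun y => `|r y|)}.
    apply: continuous_subspaceT => y.
    by apply: cvg_norm; exact: cr.
  have [c _ cP] := EVT_max (@ler01 R) cr01.
  exists `|r c| => y y0; have /andP[y1 y2] := Num.Theory.truncn_itv y0.
  rewrite -(subrK (Num.truncn y)%:R y) rn; apply: cP.
  by rewrite in_itv /= subr_ge0 y1 /= lerBlDr addrC natr1 ltW.
have rh (h : R) : 0 <= h -> forall x, r (x + h) = r x.
  move=> h0; have [ph phE] := pol h.
  pose P := ph - (q \Po ('X + h%:P) - q) : {poly R}.
  have PE x : r (x + h) - r x = P.[x].
    by rewrite /P /r !hornerE horner_comp !hornerE -phE; ring.
  have Pn (n : nat) : P.[n%:R] = P.[0].
    rewrite -(PE n%:R) -(PE 0) add0r [n%:R + h]addrC rn.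
    by rewrite -[n%:R]add0r rn.
  have Pc : P = P.[0]%:P.
    apply/eqP; rewrite -subr_eq0; apply/eqP; apply: poly0_of_nat_roots => n.
    by rewrite hornerD hornerN hornerC Pn subrr.
  have rE x : r (x + h) = r x + P.[0].
    by rewrite -(subrK (r x) (r (x + h))) PE {1}Pc hornerC addrC.
  have rnh (n : nat) : r (n%:R * h) = r 0 + n%:R * P.[0].
    elim: n => [|n IHn]; first by rewrite !mul0r addr0.
    by rewrite -natr1 !mulrDl !mul1r rE IHn addrA.
  suff P0 : P.[0] = 0 by move=> x; rewrite rE P0 addr0.
  apply/eqP; rewrite -normr_le0 leNgt; apply/negP => P0.
  (* [r (n * h) - r 0] equals [n * P.[0]] and is bounded by [C + C] in absolute
     value *)
  pose n := (Num.truncn ((C + C) / `|P.[0]|)).+1.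
  have : (C + C) / `|P.[0]| < n%:R by apply: truncnS_gt.
  rewrite ltr_pdivrMr // ltNge => /negP; apply.
  have -> : n%:R * `|P.[0]| = `|r (n%:R * h) - r 0|.
    by rewrite rnh addrAC subrr add0r normrM normr_nat.
  apply: le_trans (ler_normB _ _) _.
  by rewrite lerD // rC // mulr_ge0.
exists (q + (r 0)%:P) => x; rewrite hornerD hornerC.
suff -> : r 0 = r x by rewrite /r addrC subrK.
have [x0|/ltW x0] := leP 0 x; first by rewrite -(rh x x0 0) add0r.
by rewrite -[RHS](rh (- x)) ?oppr_ge0 // subrr.
Qed.

Lemma approximable_monomial (R : realType) (act : R -> R) (T : R) (k : nat) :
  0 <= T -> admissible_activation act -> approximable act T (fun t => t ^+ k).
Proof.
move=> T0 [cact npoly].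
have [hs [sz [b nz]]] : exists hs, size hs = k /\ exists b, mdiff hs act b != 0.
  apply: contrapT => H; apply: npoly; apply: (poly_of_mdiff0 (k := k)) => //.
  move=> hs sz x; apply/eqP/negPn/negP => nz.
  by apply: H; exists hs; split => //; exists x.
apply: approximable_lim => e e0.
exists (fun t => (mdiff hs act b)^-1 * (t ^+ size hs * mdiff hs act (0 * t + b))).
  by apply: approximableZ; exact: approximable_mdiff.
move=> t _; rewrite mul0r add0r [t ^+ _ * _]mulrC mulKf // sz subrr normr0.
exact: ltW.
Qed.

(** The Bernstein operator: the expectation of [phi] under the binomial law of
    parameters [N] and [x], by conditioning on the first trial. *)
Fixpoint bernstein (R : realType) (N : nat) (phi : nat -> R) (x : R) : R :=
  if N is N'.+1 then
    x * bernstein N' (fun k => phi k.+1) x + (1 - x) * bernstein N' phi x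
  else phi 0.

Lemma ler_bernstein (R : realType) N (phi psi : nat -> R) (x : R) :
  0 <= x <= 1 -> (forall k, (k <= N)%N -> phi k <= psi k) ->
  bernstein N phi x <= bernstein N psi x.
Proof.
move=> /andP[x0 x1]; elim: N phi psi => [|N IH] phi psi H /=; first exact: H.
apply: lerD; apply: ler_wpM2l; rewrite ?subr_ge0 //; apply: IH => k kN.
  exact: H.
by apply: H; rewrite ltnW.
Qed.

(** The second moment of the binomial law about [- c]. *)
Lemma bernstein_sqr (R : realType) N (A M c x : R) :
  bernstein N (fun k => A + M * (k%:R + c) ^+ 2) x =
  A + M * ((c + N%:R * x) ^+ 2 + N%:R * (x * (1 - x))).
Proof.
elim: N c => [|N IH] c /=; first by ring.
have -> : (fun k : nat => A + M * (k.+1%:R + c) ^+ 2) =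
          (fun k : nat => A + M * (k%:R + (1 + c)) ^+ 2).
  by apply: funext => k; rewrite -natr1 addrA.
by rewrite !IH -natr1; ring.
Qed.

Lemma bernstein_poly (R : realType) N (phi : nat -> R) :
  exists p : {poly R}, forall x, bernstein N phi x = p.[x].
Proof.
elim: N phi => [|N IH] phi; first by exists (phi 0)%:P => x; rewrite hornerC.
have [p pE] := IH (fun k => phi k.+1); have [q qE] := IH phi.
by exists ('X * p + (1 - 'X) * q) => x; rewrite !hornerE /= pE qE.
Qed.

(** Chebyshev's argument: near [t] the oscillation of [f] is at most [e / 2], and
    elsewhere it is at most a multiple of the squared deviation, whose mean is the
    variance. *)
Theorem weierstrass (R : realType) (f : R -> R) (T e : R) :
  continuous f -> 0 < T -> 0 < e ->
  exists p : {poly R}, forall t, 0 <= t <= T -> `|f t - p.[t]| <= e.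
Proof.
move=> cf T0 e0; have e2 : 0 < e / 2 by rewrite divr_gt0.
have [d [d0 hd]] := filter_ex (filterI (nbhs_right_gt 0) (@heine R f 0 T _ cf e2)).
have [C [C0 fC]] : exists C : R, 0 < C /\ forall t : R, 0 <= t <= T -> `|f t| <= C.
  have cfT : {within `[0, T], continuous (fun t => `|f t|)}.
    by apply: continuous_subspaceT => t; apply: cvg_norm; exact: cf.
  have [c _ cP] := EVT_max (ltW T0) cfT.
  exists (`|f c| + 1); split; first by rewrite ltr_wpDl.
  by move=> t tT; apply: le_trans (cP t _) _; rewrite ?in_itv //= lerDl.
pose K := 2 * C * (T / d) ^+ 2.
have K0 : 0 < K by rewrite !mulr_gt0 // ?invr_gt0.
pose N := (Num.truncn (K / (e / 2))).+1.
have N0 : 0 < N%:R :> R by rewrite ltr0n.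
have KN : K / N%:R <= e / 2.
  by rewrite ler_pdivrMr // mulrC -ler_pdivrMr // ltW // truncnS_gt.
pose phi k := f (T * (k%:R / N%:R)).
have [p pE] := bernstein_poly N phi.
exists (p \Po (T^-1 *: 'X)) => t tT; have /andP[t0 t1] := tT.
rewrite horner_comp !hornerE -pE; set x := T^-1 * t.
have x01 : 0 <= x <= 1.
  by rewrite mulr_ge0 ?invr_ge0 ?(ltW T0) //= /x mulrC ler_pdivrMr // mul1r.
have tE : t = T * x by rewrite /x mulrA divff ?mul1r // gt_eqF.
pose M := K / N%:R ^+ 2.
have key k : (k <= N)%N -> `|phi k - f t| <= e / 2 + M * (k%:R + - (N%:R * x)) ^+ 2.
  move=> kN; have M2 : M * (k%:R + - (N%:R * x)) ^+ 2 =
      2 * C * ((T * (k%:R / N%:R) - t) / d) ^+ 2.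
    by rewrite /M /K tE; field; rewrite !gt_eqF.
  rewrite M2 /phi; set s := T * _.
  have [sd|sd] := leP `|s - t| d.
    rewrite -[leLHS]addr0; apply: lerD; first exact: hd.
    by rewrite mulr_ge0 ?sqr_ge0 // mulr_ge0 // ltW.
  have sT : 0 <= s <= T.
    rewrite /s mulr_ge0 ?divr_ge0 ?(ltW T0) //=.
    by rewrite ler_piMr ?(ltW T0) // ler_pdivrMr // mul1r ler_nat.
  have h : 1 <= ((s - t) / d) ^+ 2.
    rewrite -real_normK ?num_real // -[leLHS](expr1n _ 2) lerXn2r ?nnegrE //.
    by rewrite normrM normfV (gtr0_norm d0) ler_pdivlMr // mul1r ltW.
  have h2 : 2 * C <= 2 * C * ((s - t) / d) ^+ 2.
    by rewrite ler_peMr // mulr_ge0 // ltW.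
  apply: le_trans (ler_normB _ _) _; apply: (@le_trans _ _ (C + C)).
    by rewrite lerD ?fC.
  by move: h2; set Y := 2 * C * _ ^+ 2; lra.
have sum A B : bernstein N (fun k => A + B * (k%:R + - (N%:R * x)) ^+ 2) x =
    A + B * (N%:R * (x * (1 - x))).
  by rewrite bernstein_sqr addNr expr0n add0r.
have MN : M * (N%:R * (x * (1 - x))) <= e / 2.
  have -> : M * (N%:R * (x * (1 - x))) = K / N%:R * (x * (1 - x)).
    by rewrite /M; field; rewrite gt_eqF.
  apply: le_trans KN; rewrite ler_piMr ?divr_ge0 ?ltW //.
  by case/andP: x01 => x0 x1; nra.
have up : bernstein N phi x <= f t + e / 2 + M * (N%:R * (x * (1 - x))).
  rewrite -sum; apply: ler_bernstein => // k kN.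
  by have := key k kN; rewrite ler_norml => /andP[_]; lra.
have lo : f t - e / 2 + - M * (N%:R * (x * (1 - x))) <= bernstein N phi x.
  rewrite -sum; apply: ler_bernstein => // k kN.
  by have := key k kN; rewrite ler_norml => /andP[+ _]; lra.
by rewrite ler_norml; apply/andP; split; lra.
Qed.

(** Universal approximation for networks with one input and one hidden layer. *)
Theorem universal_approximation (R : realType) (act : R -> R) (T : R) f :
  0 < T -> admissible_activation act -> continuous f -> approximable act T f.
Proof.
move=> T0 hact cf; apply: approximable_lim => e e0.
have [p pP] := weierstrass cf T0 e0.
exists (fun t => \sum_(i <- enum 'I_(size p)) p`_i * t ^+ i).
  apply: approximable_sum => i; apply: approximableZ.
  by apply: approximable_monomial => //; exact: ltW.
by move=> t tT; rewrite big_enum -horner_coef pP.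
Qed.

(** * Continuous paths of matrices *)

(** Entrywise continuity of a matrix valued path. *)
Definition mx_continuous (R : realType) (m n : nat) (F : R -> 'M[R]_(m, n)) :=
  forall i j, continuous (fun t => F t i j).

Section MxContinuous.
Context (R : realType).

Lemma continuous_bigsum (I : Type) (r : seq I) (F : I -> R -> R) :
  (forall i, continuous (F i)) -> continuous (fun t => \sum_(i <- r) F i t).
Proof.
move=> cF; elim: r => [|i r IH].
  by under eq_fun do rewrite big_nil; move=> t; exact: cvg_cst.
under eq_fun do rewrite big_cons.
by move=> t; apply: cvgD; [exact: cF|exact: IH].
Qed.

Lemma continuous_bigprod (I : Type) (r : seq I) (F : I -> R -> R) :
  (forall i, continuous (F i)) -> continuous (fun t => \prod_(i <- r) F i t).
Proof.
move=> cF; elim: r => [|i r IH].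
  by under eq_fun do rewrite big_nil; move=> t; exact: cvg_cst.
under eq_fun do rewrite big_cons.
by move=> t; apply: cvgM; [exact: cF|exact: IH].
Qed.

Lemma mx_continuous_cst m n (A : 'M[R]_(m, n)) : mx_continuous (fun=> A).
Proof. by move=> i j t; exact: cvg_cst. Qed.

Lemma mx_continuousD m n (F G : R -> 'M[R]_(m, n)) :
  mx_continuous F -> mx_continuous G -> mx_continuous (fun t => F t + G t).
Proof.
move=> cF cG i j; under eq_fun do rewrite mxE.
by move=> t; apply: cvgD; [exact: cF|exact: cG].
Qed.

Lemma mx_continuousN m n (F : R -> 'M[R]_(m, n)) :
  mx_continuous F -> mx_continuous (fun t => - F t).
Proof.
move=> cF i j; under eq_fun do rewrite mxE.
by move=> t; apply: cvgN; exact: cF.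
Qed.

Lemma mx_continuousZ m n (a : R -> R) (F : R -> 'M[R]_(m, n)) :
  continuous a -> mx_continuous F -> mx_continuous (fun t => a t *: F t).
Proof.
move=> ca cF i j; under eq_fun do rewrite mxE.
by move=> t; apply: cvgM; [exact: ca|exact: cF].
Qed.

Lemma mx_continuousM m n p (F : R -> 'M[R]_(m, n)) (G : R -> 'M[R]_(n, p)) :
  mx_continuous F -> mx_continuous G -> mx_continuous (fun t => F t *m G t).
Proof.
move=> cF cG i j; under eq_fun do rewrite mxE.
apply: continuous_bigsum => k t.
by apply: cvgM; [exact: cF|exact: cG].
Qed.

Lemma mx_continuousT m n (F : R -> 'M[R]_(m, n)) :
  mx_continuous F -> mx_continuous (fun t => (F t)^T).
Proof. by move=> cF i j; under eq_fun do rewrite mxE; exact: cF. Qed.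

Lemma mx_continuous_block m1 m2 n1 n2 (A : R -> 'M[R]_(m1, n1))
    (B : R -> 'M[R]_(m1, n2)) (C : R -> 'M[R]_(m2, n1)) (D : R -> 'M[R]_(m2, n2)) :
  mx_continuous A -> mx_continuous B -> mx_continuous C -> mx_continuous D ->
  mx_continuous (fun t => block_mx (A t) (B t) (C t) (D t)).
Proof.
move=> cA cB cC cD i j.
case: (split_ordP i) => k ->; case: (split_ordP j) => l ->.
- by under eq_fun do rewrite block_mxEul; exact: cA.
- by under eq_fun do rewrite block_mxEur; exact: cB.
- by under eq_fun do rewrite block_mxEdl; exact: cC.
- by under eq_fun do rewrite block_mxEdr; exact: cD.
Qed.

Lemma mx_continuous_ulsub m1 m2 n1 n2 (F : R -> 'M[R]_(m1 + m2, n1 + n2)) :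
  mx_continuous F -> mx_continuous (fun t => ulsubmx (F t)).
Proof. by move=> cF i j; under eq_fun do rewrite !mxE; exact: cF. Qed.

Lemma mx_continuous_ursub m1 m2 n1 n2 (F : R -> 'M[R]_(m1 + m2, n1 + n2)) :
  mx_continuous F -> mx_continuous (fun t => ursubmx (F t)).
Proof. by move=> cF i j; under eq_fun do rewrite !mxE; exact: cF. Qed.

Lemma mx_continuous_dlsub m1 m2 n1 n2 (F : R -> 'M[R]_(m1 + m2, n1 + n2)) :
  mx_continuous F -> mx_continuous (fun t => dlsubmx (F t)).
Proof. by move=> cF i j; under eq_fun do rewrite !mxE; exact: cF. Qed.

Lemma mx_continuous_drsub m1 m2 n1 n2 (F : R -> 'M[R]_(m1 + m2, n1 + n2)) :
  mx_continuous F -> mx_continuous (fun t => drsubmx (F t)).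
Proof. by move=> cF i j; under eq_fun do rewrite !mxE; exact: cF. Qed.

Lemma continuous_det n (F : R -> 'M[R]_n) :
  mx_continuous F -> continuous (fun t => \det (F t)).
Proof.
move=> cF; apply: continuous_bigsum => s t; apply: cvgM; first exact: cvg_cst.
by apply: continuous_bigprod => i; exact: cF.
Qed.

Lemma mx_continuousV n (F : R -> 'M[R]_n) : mx_continuous F ->
  (forall t, F t \in unitmx) -> mx_continuous (fun t => invmx (F t)).
Proof.
move=> cF uF.
have -> : (fun t => invmx (F t)) = (fun t => (\det (F t))^-1 *: \adj (F t)).
  by apply: funext => t; rewrite /invmx uF.
apply: mx_continuousZ.
  move=> t; apply: cvgV; last exact: continuous_det.
  by rewrite -unitfE -unitmxE.
move=> i j; under eq_fun do rewrite mxE.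
move=> t; apply: cvgM; first exact: cvg_cst.
apply: continuous_det => k l.
by under eq_fun do rewrite !mxE; exact: cF.
Qed.

End MxContinuous.

(** * Products of symmetric matrices *)

(** Paths of matrices that are finite products of continuous paths of invertible
    symmetric matrices. *)
Inductive sym_product (R : realType) (n : nat) : (R -> 'M[R]_n) -> Prop :=
| sym_product_sym S : mx_continuous S -> (forall t, (S t)^T = S t) ->
    (forall t, S t \in unitmx) -> sym_product S
| sym_product_mul P Q : sym_product P -> sym_product Q ->
    sym_product (fun t => P t *m Q t).

Section SymProduct.
Context (R : realType).

Lemma sym_product_unit n (P : R -> 'M[R]_n) :
  sym_product P -> forall t, P t \in unitmx.
Proof. by elim=> {P} [//|P Q _ uP _ uQ] t; rewrite unitmx_mul uP uQ. Qed.

Lemma sym_product_tr n (P : R -> 'M[R]_n) :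
  sym_product P -> sym_product (fun t => (P t)^T).
Proof.
elim=> {P} [S cS sS uS|P Q _ IHP _ IHQ].
  apply: sym_product_sym => [|t|t]; rewrite ?unitmx_tr //; last by rewrite sS.
  exact: mx_continuousT.
under eq_fun do rewrite trmx_mul.
exact: sym_product_mul.
Qed.

Lemma unitmx_block_diag m n (A : 'M[R]_m) (D : 'M[R]_n) :
  (block_mx A 0 0 D \in unitmx) = (A \in unitmx) && (D \in unitmx).
Proof. by rewrite !unitmxE det_ublock unitrM. Qed.

Lemma unitmx_block_upper m n (B : 'M[R]_(m, n)) :
  block_mx 1%:M B 0 1%:M \in unitmx.
Proof. by rewrite unitmxE det_ublock !det1 mul1r unitr1. Qed.

Lemma sym_product_lift n (P : R -> 'M[R]_n) : sym_product P ->
  sym_product (fun t => block_mx 1%:M 0 0 (P t) : 'M[R]_(1 + n)).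
Proof.
elim=> {P} [S cS sS uS|P Q _ IHP _ IHQ].
  apply: sym_product_sym => [|t|t].
  - by apply: mx_continuous_block => //; exact: mx_continuous_cst.
  - by rewrite tr_block_mx !trmx0 trmx1 sS.
  - by rewrite unitmx_block_diag unitmx1 uS.
have -> : (fun t => block_mx 1%:M 0 0 (P t *m Q t) : 'M[R]_(1 + n)) =
    (fun t => block_mx 1%:M 0 0 (P t) *m block_mx 1%:M 0 0 (Q t)).
  apply: funext => t.
  by rewrite mulmx_block !(mul0mx, mulmx0, mul1mx, addr0, add0r).
exact: sym_product_mul.
Qed.

(** With [M] the transvection of half the size and [Z] the reflection
    [diag(-1, 1)], the transvection is the commutator [M Z M^-1 Z], that is
    [(M Z M^T) (M^-T M^-1) Z]. *)
Lemma sym_product_transvection n (b : R -> 'rV[R]_n) : mx_continuous b ->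
  sym_product (fun t => block_mx 1%:M (b t) 0 1%:M : 'M[R]_(1 + n)).
Proof.
move=> cb.
pose M t : 'M[R]_(1 + n) := block_mx 1%:M (2^-1 *: b t) 0 1%:M.
pose M' t : 'M[R]_(1 + n) := block_mx 1%:M (- (2^-1 *: b t)) 0 1%:M.
pose Z : 'M[R]_(1 + n) := block_mx (- 1%:M) 0 0 1%:M.
have cst m p (A : 'M[R]_(m, p)) := @mx_continuous_cst R m p A.
have cb2 : mx_continuous (fun t => 2^-1 *: b t).
  by apply: mx_continuousZ => // t; exact: cvg_cst.
have cM : mx_continuous M by exact: mx_continuous_block.
have cM' : mx_continuous M'.
  by apply: mx_continuous_block => //; exact: mx_continuousN.
have uM t : M t \in unitmx by exact: unitmx_block_upper.
have uM' t : M' t \in unitmx by exact: unitmx_block_upper.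
have uZ : Z \in unitmx.
  by rewrite unitmx_block_diag unitmx1 andbT -scaleN1r unitmxZ ?unitmx1 // unitrN1.
have ZT : Z^T = Z by rewrite tr_block_mx linearN /= !trmx0 !trmx1.
have half : 2^-1 + 2^-1 = 1 :> R by field.
have M'M t : M' t *m M t = 1%:M.
  rewrite mulmx_block !(mul0mx, mulmx0, mul1mx, mulmx1, addr0, add0r) subrr.
  by rewrite -scalar_mx_block.
have -> : (fun t => block_mx 1%:M (b t) 0 1%:M : 'M[R]_(1 + n)) =
    (fun t => ((M t *m Z *m (M t)^T) *m ((M' t)^T *m M' t)) *m Z).
  apply: funext => t.
  rewrite -!mulmxA (mulmxA (M t)^T) -trmx_mul M'M trmx1 mul1mx /M /M' /Z.
  rewrite !mulmx_block !(mulmxN, mulNmx).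
  rewrite !(mul0mx, mulmx0, mul1mx, mulmx1, addr0, add0r, oppr0, opprK).
  by congr block_mx; rewrite -scalerDl half scale1r.
apply: sym_product_mul; first apply: sym_product_mul.
- apply: sym_product_sym => [|t|t].
  + by do 2?apply: mx_continuousM => //; exact: mx_continuousT.
  + by rewrite !trmx_mul trmxK ZT mulmxA.
  + by rewrite !unitmx_mul unitmx_tr uM uZ.
- apply: sym_product_sym => [|t|t].
  + by apply: mx_continuousM => //; exact: mx_continuousT.
  + by rewrite trmx_mul trmxK.
  + by rewrite unitmx_mul unitmx_tr uM'.
- exact: sym_product_sym.
Qed.

(** The Schur complement of the first diagonal entry. *)
Definition schur n (A : 'M[R]_(1 + n)) : 'M[R]_n :=
  drsubmx A - (A 0 0)^-1 *: (dlsubmx A *m ursubmx A).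

Lemma block_LDU n (A : 'M[R]_(1 + n)) : A 0 0 != 0 ->
  A = block_mx 1%:M 0 ((A 0 0)^-1 *: dlsubmx A) 1%:M *m
      (block_mx (A 0 0)%:M 0 0 1%:M *m block_mx 1%:M 0 0 (schur A)) *m
      block_mx 1%:M ((A 0 0)^-1 *: ursubmx A) 0 1%:M.
Proof.
move=> a0; rewrite !mulmx_block !(mul0mx, mulmx0, mul1mx, mulmx1, addr0, add0r).
rewrite -[LHS]submxK; congr block_mx.
- rewrite [LHS]mx11_scalar !mxE; congr (A _ _)%:M; exact: val_inj.
- by rewrite mul_scalar_mx scalerA divff ?scale1r.
- by rewrite mul_mx_scalar scalerA divff ?scale1r.
- rewrite mul_mx_scalar scalerA divff // scale1r -scalemxAr.
  by rewrite /schur addrC subrK.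
Qed.

Lemma sym_product_schur n (P : R -> 'M[R]_(1 + n)) : mx_continuous P ->
  (forall t, P t 0 0 != 0) -> sym_product (fun t => schur (P t)) -> sym_product P.
Proof.
move=> cP P0 sP.
have ca : continuous (fun t => (P t 0 0)^-1).
  by move=> t; apply: cvgV; [exact: P0|exact: cP].
have -> : P = (fun t => block_mx 1%:M 0 ((P t 0 0)^-1 *: dlsubmx (P t)) 1%:M *m
      (block_mx (P t 0 0)%:M 0 0 1%:M *m block_mx 1%:M 0 0 (schur (P t))) *m
      block_mx 1%:M ((P t 0 0)^-1 *: ursubmx (P t)) 0 1%:M).
  by apply: funext => t; exact: (block_LDU (P0 t)).
apply: sym_product_mul; first apply: sym_product_mul.
- have -> : (fun t => block_mx 1%:M 0 ((P t 0 0)^-1 *: dlsubmx (P t)) 1%:M) =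
      (fun t =>
        (block_mx 1%:M ((P t 0 0)^-1 *: (dlsubmx (P t))^T) 0 1%:M : 'M[R]_(1 + n))^T).
    by apply: funext => t; rewrite tr_block_mx !trmx1 trmx0 linearZ /= trmxK.
  apply: sym_product_tr; apply: sym_product_transvection.
  apply: mx_continuousZ => //; apply: mx_continuousT; exact: mx_continuous_dlsub.
- apply: sym_product_mul; last exact: sym_product_lift.
  apply: sym_product_sym => [|t|t].
  + apply: mx_continuous_block; try exact: mx_continuous_cst.
    move=> i j; rewrite !ord1; under eq_fun do rewrite mxE eqxx mulr1n.
    exact: cP.
  + by rewrite tr_block_mx !trmx0 trmx1 tr_scalar_mx.
  + by rewrite unitmx_block_diag unitmx1 andbT unitmxE det_scalar1 unitfE.
- apply: sym_product_transvection.
  apply: mx_continuousZ => //; exact: mx_continuous_ursub.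
Qed.

Lemma schur_unit n (A : 'M[R]_(1 + n)) : A 0 0 != 0 ->
  A \in unitmx -> schur A \in unitmx.
Proof.
move=> a0; rewrite {1}(block_LDU a0) !unitmx_mul => /andP[/andP[_ /andP[_]]].
by rewrite unitmx_block_diag => /andP[].
Qed.

(** A transposition brings a nonzero entry of the first column to the pivot. *)
Lemma sym_product_cst n (A : 'M[R]_n) : A \in unitmx -> sym_product (fun=> A).
Proof.
elim: n A => [|n IH] A uA.
  apply: sym_product_sym => // [|t]; first exact: mx_continuous_cst.
  by apply/matrixP => -[].
have pivot (B : 'M[R]_(1 + n)) : B \in unitmx -> B 0 0 != 0 -> sym_product (fun=> B).
  move=> uB B0; apply: sym_product_schur => //; first exact: mx_continuous_cst.
  by apply: IH; exact: schur_unit.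
have [i Ai] : exists i, A i 0 != 0.
  apply/existsP; apply: contraT; rewrite negb_exists => /forallP A0.
  move: uA; rewrite unitmxE (expand_det_col _ 0) big1 ?unitr0 // => i _.
  by have := A0 i; rewrite negbK => /eqP ->; rewrite mul0r.
pose X : 'M[R]_n.+1 := tperm_mx 0 i.
have uX : X \in unitmx by exact: unitmx_perm.
have XX : X *m X = 1%:M by rewrite -perm_mxM tperm2 perm_mx1.
have -> : (fun=> A) = (fun t : R => X *m (X *m A)).
  by apply: funext => t; rewrite mulmxA XX mul1mx.
apply: sym_product_mul.
  apply: sym_product_sym => // [|t]; first exact: mx_continuous_cst.
  by rewrite tr_perm_mx tpermV.
apply: (pivot (X *m A)); first by rewrite unitmx_mul uX.
by rewrite -xrowE mxE tpermL.
Qed.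

(** Elimination without pivoting works for paths with positive quadratic form,
    because Schur complements inherit the positivity. *)
Lemma sym_product_pos n (P : R -> 'M[R]_n) : mx_continuous P ->
  (forall t (v : 'cV_n), v != 0 -> 0 < (v^T *m P t *m v) 0 0) -> sym_product P.
Proof.
elim: n P => [|n IH] P cP pos.
  have P1 t : P t = 1%:M by apply/matrixP => -[].
  apply: sym_product_sym => // t; rewrite P1 ?unitmx1 //; exact: trmx1.
have P0 t : P t 0 0 != 0.
  have := pos t (delta_mx 0 0).
  rewrite trmx_delta -rowE -colE !mxE => H; apply: lt0r_neq0; apply: H.
  by apply/eqP => /matrixP /(_ 0 0); rewrite !mxE /= => /eqP; rewrite oner_eq0.
apply: (@sym_product_schur n) => //; apply: IH => [|t v v0].
  apply: mx_continuousD; first exact: mx_continuous_drsub.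
  apply: mx_continuousN; apply: mx_continuousZ.
    by move=> t; apply: cvgV; [exact: P0|exact: cP].
  by apply: mx_continuousM; [exact: mx_continuous_dlsub|exact: mx_continuous_ursub].
(* the first entry of w is chosen so that the first entry of [P t *m w] vanishes *)
pose w0 := - ((P t 0 0)^-1 *: (@ursubmx _ 1 n 1 n (P t) *m v)).
pose w : 'cV[R]_(1 + n) := col_mx w0 v.
have wn0 : w != 0.
  apply: contraNneq v0 => w_eq0.
  by rewrite -[v](col_mxKd w0) -/w w_eq0 linear0.
have := pos t w wn0; rewrite -mulmxA.
have E1 : @ulsubmx _ 1 n 1 n (P t) *m w0 + @ursubmx _ 1 n 1 n (P t) *m v = 0.
  rewrite /w0 [ulsubmx _]mx11_scalar mulmxN mul_scalar_mx scalerA !mxE.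
  rewrite (_ : P t _ _ = P t 0 0) ?divff ?scale1r ?addNr //.
  congr (P t _ _); exact: val_inj.
have E2 : @dlsubmx _ 1 n 1 n (P t) *m w0 + @drsubmx _ 1 n 1 n (P t) *m v =
    schur (P t) *m v.
  by rewrite /w0 /schur mulmxBl mulmxN -scalemxAr -scalemxAl -mulmxA addrC.
rewrite -{1}[P t](@submxK _ 1 n 1 n) /w (@mul_block_col _ 1 n 1 n) E1 E2.
by rewrite (@tr_col_mx _ 1 n) (@mul_row_col _ _ 1 n) mulmx0 add0r mulmxA.
Qed.

End SymProduct.

(** * Sup norms of matrices *)

Section MatrixNorm.
Context (R : realType).

Lemma ler_entry_mx_norm m n (M : 'M[R]_(m, n)) i j : `|M i j| <= `|M|.
Proof.
rewrite [leRHS]/Num.Def.normr /= mx_normrE.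
by apply/bigmax_geP; right => /=; exists (i, j).
Qed.

Lemma mx_norm_ler m n (M : 'M[R]_(m, n)) c : 0 <= c ->
  (forall i j, `|M i j| <= c) -> `|M| <= c.
Proof.
move=> c0 H; rewrite [leLHS]/Num.Def.normr /= mx_normrE.
by apply: bigmax_le => // -[i j] _; exact: H.
Qed.

Lemma ler_norm_mulmx m n p (M : 'M[R]_(m, n)) (N : 'M[R]_(n, p)) :
  `|M *m N| <= n%:R * `|M| * `|N|.
Proof.
apply: mx_norm_ler => [|i j]; first by rewrite !mulr_ge0.
rewrite mxE; apply: le_trans (ler_norm_sum _ _ _) _.
apply: (@le_trans _ _ (\sum_(k < n) `|M| * `|N|)).
  by apply: ler_sum => k _; rewrite normrM ler_pM // ler_entry_mx_norm.
by rewrite sumr_const card_ord -mulrA mulr_natl.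
Qed.

Lemma ler_norm_col_mx m1 m2 n (A : 'M[R]_(m1, n)) (B : 'M[R]_(m2, n)) c :
  `|A| <= c -> `|B| <= c -> `|col_mx A B| <= c.
Proof.
move=> hA hB; apply: mx_norm_ler => [|i j]; first exact: le_trans hA.
case: (split_ordP i) => k ->; rewrite (col_mxEu, col_mxEd).
  exact: le_trans (ler_entry_mx_norm _ _ _) hA.
exact: le_trans (ler_entry_mx_norm _ _ _) hB.
Qed.

Lemma ler_norm_usubmx m1 m2 n (A : 'M[R]_(m1 + m2, n)) : `|usubmx A| <= `|A|.
Proof. by apply: mx_norm_ler => // i j; rewrite mxE ler_entry_mx_norm. Qed.

Lemma ler_norm_dsubmx m1 m2 n (A : 'M[R]_(m1 + m2, n)) : `|dsubmx A| <= `|A|.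
Proof. by apply: mx_norm_ler => // i j; rewrite mxE ler_entry_mx_norm. Qed.

Lemma mx_continuous_bounded m n (F : R -> 'M[R]_(m, n)) (T : R) :
  0 <= T -> mx_continuous F ->
  exists2 C : R, 0 <= C & forall t : R, 0 <= t <= T -> `|F t| <= C.
Proof.
move=> T0 cF.
pose S t := \sum_i \sum_j `|F t i j|.
have cS : continuous S.
  apply: continuous_bigsum => i; apply: continuous_bigsum => j t.
  by apply: cvg_norm; exact: cF.
have [c _ cP] := EVT_max T0 (continuous_subspaceT (A := `[0, T]) cS).
have S0 t : 0 <= S t by do 2?[apply: sumr_ge0 => ? _].
exists (S c) => // t tT; apply: mx_norm_ler => // i j.
apply: le_trans (cP t _); last by rewrite in_itv.
rewrite /S (bigD1 i) //= (bigD1 j) //= -addrA lerDl addr_ge0 //.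
  by apply: sumr_ge0.
by do 2?[apply: sumr_ge0 => ? _].
Qed.

End MatrixNorm.

(** * Families of maps approximated by nets *)

(** The network with one hidden layer of width [m] and scalar output that
    computes [net_sum act s]; missing neurons get output weight 0. *)
Definition shallow_fcnn (R : realType) (s : seq (R * R * R)) (m : nat) :
    fcnn R 0 m 1 :=
  let x (i : 'I_m) := nth (0, 0, 0) s i in
  Fcnn (\col_i (x i).1.2, \col_i (x i).2) [tuple]
       (\matrix_(_ < 1, i < m) (x i).1.1, 0).

Lemma shallow_fcnnE (R : realType) (act : R -> R) (s : seq (R * R * R)) m t :
  (size s <= m)%N -> fcnn_eval act (shallow_fcnn s m) t = (net_sum act s t)%:M.
Proof.
move=> sm; rewrite [LHS]mx11_scalar; congr (_%:M).
rewrite /fcnn_eval /= addr0 mxE /net_sum (big_nth (0, 0, 0)) big_mkord.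
pose F i := (nth (0, 0, 0) s i).1.1 *
  act ((nth (0, 0, 0) s i).1.2 * t + (nth (0, 0, 0) s i).2).
rewrite (big_ord_widen _ F sm) [RHS]big_mkcond /=.
apply: eq_bigr => i _; rewrite !mxE /F; case: ltnP => si.
  by rewrite [t * _]mulrC.
by rewrite nth_default //= mul0r.
Qed.

Section Realizable.
Context (R : realType) (act : R -> R) (n : nat) (T : R).
Hypotheses (T_gt0 : 0 < T) (act_adm : admissible_activation act).
Local Notation vec := 'cV[R]_(n + n).
Implicit Types Psi : R -> vec -> vec.

(** Families of maps that are Lipschitz and bounded at 0 uniformly in time. *)
Definition uniformly_lipschitz Psi := exists2 C : R, 0 <= C &
  forall t : R, 0 <= t <= T ->
    (forall z z', `|Psi t z - Psi t z'| <= C * `|z - z'|) /\ `|Psi t 0| <= C.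

(** The map computed at time [t] by a sequence of layers of width 1. *)
Definition run m (s : seq (tl_unit R n 1 0 m * tl_unit R n 1 0 m)) t z :=
  foldl (fun y th => tl_up act th.2 t (tl_low act th.1 t y)) z s.

(** Families that are limits, uniformly on bounded sets and in time, of nets of
    width 1 with one hidden sublayer.  Asking for nets of every large subwidth
    [m] is what lets two nets be composed. *)
Definition net_limit Psi := forall B e, 0 < e -> exists m0, forall m,
  (m0 <= m)%N -> exists s : seq (tl_unit R n 1 0 m * tl_unit R n 1 0 m),
  forall t z, 0 <= t <= T -> `|z| <= B -> `|run s t z - Psi t z| <= e.

Definition realizable Psi := uniformly_lipschitz Psi /\ net_limit Psi.

Lemma realizable_comp Psi1 Psi2 : realizable Psi1 -> realizable Psi2 ->
  realizable (fun t z => Psi1 t (Psi2 t z)).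
Proof.
move=> [[C1 C10 L1] N1] [[C2 C20 L2] N2]; split.
  exists (C1 * C2 + C1) => [|t tT]; first by rewrite addr_ge0 // mulr_ge0.
  have [l1 b1] := L1 t tT; have [l2 b2] := L2 t tT; split=> [z z'|].
    apply: le_trans (l1 _ _) _; apply: (@le_trans _ _ (C1 * (C2 * `|z - z'|))).
      by rewrite ler_wpM2l.
    by rewrite mulrA ler_wpM2r // lerDl.
  rewrite -(subrK (Psi1 t 0) (Psi1 t _)); apply: le_trans (ler_normD _ _) _.
  rewrite lerD //; apply: le_trans (l1 _ _) _.
  by rewrite subr0 ler_wpM2l.
move=> B e e0; have e2 : 0 < e / 2 by rewrite divr_gt0.
have C11 : 0 < C1 + 1 by rewrite ltr_wpDl.
pose e' := Num.min 1 (e / 2 / (C1 + 1)).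
have e'0 : 0 < e' by rewrite lt_min ltr01 divr_gt0.
have [m2 H2] := N2 B e' e'0.
have [m1 H1] := N1 (1 + (C2 * B + C2)) _ e2.
exists (maxn m1 m2) => m; rewrite geq_max => /andP[/H1[s1 P1] /H2[s2 P2]].
exists (s2 ++ s1) => t z tT zB.
rewrite /run foldl_cat -!/(run _ _ _).
have h2 := P2 t z tT zB; have [l2 b2] := L2 t tT.
have bz : `|Psi2 t z| <= C2 * B + C2.
  rewrite -(subrK (Psi2 t 0) (Psi2 t _)); apply: le_trans (ler_normD _ _) _.
  by rewrite lerD //; apply: le_trans (l2 _ _) _; rewrite subr0 ler_wpM2l.
have by_ : `|run s2 t z| <= 1 + (C2 * B + C2).
  rewrite -(subrK (Psi2 t z) (run s2 t z)); apply: le_trans (ler_normD _ _) _.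
  by rewrite lerD //; apply: le_trans h2 _; rewrite ge_min lexx.
have h1 := P1 t _ tT by_; have [l1 _] := L1 t tT.
rewrite (splitr e); apply: le_trans (ler_distD (Psi1 t (run s2 t z)) _ _) _.
rewrite lerD //; apply: le_trans (l1 _ _) _.
apply: (@le_trans _ _ ((C1 + 1) * e')); first by rewrite ler_pM // lerDl.
by rewrite mulrC -ler_pdivlMr // ge_min lexx orbT.
Qed.

Lemma realizable_id : realizable (fun=> id).
Proof.
split.
  by exists 1 => // t _; split=> [z z'|]; rewrite ?mul1r // normr0.
move=> B e e0; exists 0%N => m _; exists [::] => t z _ _.
by rewrite /run /= subrr normr0 ltW.
Qed.

(** The map adding to one half of [z] the function [g t] of the other half; the
    upper half is the modified one when [b] holds. *)
Definition shear (b : bool) (g : R -> 'cV[R]_n -> 'cV[R]_n) t (z : vec) : vec :=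
  if b then col_mx (g t (dsubmx z) + usubmx z) (dsubmx z)
  else col_mx (usubmx z) (dsubmx z + g t (usubmx z)).

(** The unit with row [K], bias [beta] and coefficient [net_sum act s]. *)
Definition unit_of (K : 'rV[R]_n) (beta : R) m s : tl_unit R n 1 0 m :=
  TLUnit K (shallow_fcnn s m) beta%:M.

Lemma unit_ofE K beta m s x t : (size s <= m)%N ->
  tl_sigma act (unit_of K beta m s) x t =
  net_sum act s t *: (K^T *m (K *m x + beta%:M)).
Proof.
move=> sm; rewrite /tl_sigma /= shallow_fcnnE // scalemxAr; congr (_ *m _).
by apply/matrixP => i j; rewrite !mxE !ord1 eqxx mulr1n.
Qed.

Lemma norm_shear_sub (b : bool) g h t (z : vec) e :
  0 <= e -> (forall x, `|x| <= `|z| -> `|g t x - h t x| <= e) ->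
  `|shear b g t z - shear b h t z| <= e.
Proof.
move=> e0 H; case: b => /=; rewrite opp_col_mx add_col_mx;
  apply: ler_norm_col_mx.
- by rewrite opprD addrACA subrr addr0 H // ler_norm_dsubmx.
- by rewrite subrr normr0.
- by rewrite subrr normr0.
- by rewrite opprD addrACA subrr add0r H // ler_norm_usubmx.
Qed.

(** The elementary shears: rank one quadratic (and linear) Hamiltonians with a
    continuous time dependent coefficient. *)
Lemma realizable_rank1 b (K : 'rV[R]_n) (beta : R) (alpha : R -> R) :
  continuous alpha ->
  realizable (shear b (fun t x => alpha t *: (K^T *m (K *m x + beta%:M)))).
Proof.
move=> calpha; pose h x := K^T *m (K *m x + beta%:M).
pose L := 1%N%:R * `|K^T| * (n%:R * `|K|).
have L0 : 0 <= L by rewrite !mulr_ge0.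
have lh x y : `|h x - h y| <= L * `|x - y|.
  rewrite /h -mulmxBr opprD addrACA subrr addr0 -mulmxBr /L -mulrA.
  apply: le_trans (ler_norm_mulmx _ _) _.
  by rewrite -!mulrA !ler_wpM2l // mulrA ler_norm_mulmx.
have bh x B : `|x| <= B -> `|h x| <= L * B + `|h 0|.
  move=> xB; rewrite -(subrK (h 0) (h x)); apply: le_trans (ler_normD _ _) _.
  by rewrite lerD //; apply: le_trans (lh _ _) _; rewrite subr0 ler_wpM2l.
split.
  have ca : @mx_continuous R 1 1 (fun t => (alpha t)%:M).
    by move=> i j; under eq_fun do rewrite !ord1 mxE eqxx mulr1n; exact: calpha.
  have [A A0 aA] := mx_continuous_bounded (ltW T_gt0) ca.
  have {}aA t : 0 <= t <= T -> `|alpha t| <= A.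
    move=> tT; apply: le_trans (aA t tT).
    have := ler_entry_mx_norm ((alpha t)%:M : 'M[R]_1) 0 0.
    by rewrite mxE eqxx mulr1n.
  (* [A * L + 1] bounds the Lipschitz constants, [A * `|h 0|] the values at 0 *)
  exists (A * L + 1 + A * `|h 0|) => [|t tT].
    by rewrite !addr_ge0 // mulr_ge0.
  have key x y : `|alpha t *: h x - alpha t *: h y| <= A * L * `|x - y|.
    by rewrite -scalerBr normrZ -mulrA ler_pM // aA.
  split=> [z z'|].
    set D := `|z - z'|; have D0 : 0 <= D by exact: normr_ge0.
    have hu : `|usubmx z - usubmx z'| <= D 
      by have := ler_norm_usubmx (z - z'); rewrite linearB.
    have hd : `|dsubmx z - dsubmx z'| <= D 
      by have := ler_norm_dsubmx (z - z'); rewrite linearB.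
    have AL0 : 0 <= A * L by rewrite mulr_ge0.
    have Ah0 : 0 <= A * `|h 0| by rewrite mulr_ge0.
    have c1 : D <= (A * L + 1 + A * `|h 0|) * D.
      by rewrite ler_peMl // addrAC lerDr addr_ge0.
    have c2 : A * L * D + D <= (A * L + 1 + A * `|h 0|) * D.
      by rewrite mulrDl mulrDl mul1r lerDl mulr_ge0.
    case: b; rewrite /shear opp_col_mx add_col_mx; apply: ler_norm_col_mx.
    + rewrite opprD addrACA; apply: le_trans c2; apply: le_trans (ler_normD _ _) _.
      by rewrite lerD //; apply: le_trans (key _ _) _; rewrite ler_wpM2l.
    + exact: le_trans c1.
    + exact: le_trans c1.
    + rewrite opprD addrACA addrC; apply: le_trans c2.
      apply: le_trans (ler_normD _ _) _.
      by rewrite lerD //; apply: le_trans (key _ _) _; rewrite ler_wpM2l.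
  have n0 : `|alpha t *: h 0| <= A * L + 1 + A * `|h 0|.
    apply: (@le_trans _ _ (A * `|h 0|)); first by rewrite normrZ ler_wpM2r ?aA.
    by rewrite lerDr addr_ge0 // mulr_ge0.
  have z0 : 0 <= A * L + 1 + A * `|h 0| by rewrite !addr_ge0 // mulr_ge0.
  have u0 : usubmx (0 : vec) = 0 by exact: linear0.
  have d0 : dsubmx (0 : vec) = 0 by exact: linear0.
  by case: b; rewrite /shear u0 d0 ?addr0 ?add0r; apply: ler_norm_col_mx;
    rewrite ?normr0.
move=> B e e0.
pose D := L * B + `|h 0|; have D1 : 0 < `|D| + 1 by rewrite ltr_wpDl.
have [s sP] := universal_approximation T_gt0 act_adm calpha (divr_gt0 e0 D1).
exists (size s) => m sm.
pose u := unit_of K beta m s; pose u0 := unit_of 0 0 m [::].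
exists [:: if b then (u0, u) else (u, u0)] => t z tT zB.
have u0E x : tl_sigma act u0 x t = 0.
  by rewrite unit_ofE // trmx0 mul0mx scaler0.
have -> : run [:: if b then (u0, u) else (u, u0)] t z =
    shear b (fun t x => net_sum act s t *: h x) t z.
  rewrite /run; case: b => /=; rewrite /tl_up /tl_low /=.
    rewrite u0E addr0 vsubmxK unit_ofE //.
  by rewrite !col_mxKu !col_mxKd u0E add0r unit_ofE.
apply: norm_shear_sub; first exact: ltW.
move=> x xz; rewrite -scalerBl normrZ distrC.
apply: (@le_trans _ _ (e / (`|D| + 1) * D)).
  by rewrite ler_pM // ?sP // bh // (le_trans xz).
rewrite mulrAC ler_pdivrMr // ler_wpM2l ?(ltW e0) //.
by rewrite (le_trans (ler_norm D)) // lerDl.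
Qed.

End Realizable.

(** * Shears and translations *)

(** The matrix of the linear shear with matrix [S], upper when [b] holds. *)
Definition shear_mx (R : realType) (n : nat) (b : bool) (S : 'M[R]_n) :
    'M[R]_(n + n) :=
  if b then block_mx 1%:M S 0 1%:M else block_mx 1%:M 0 S 1%:M.

Lemma shear_mxD (R : realType) n b (S S' : 'M[R]_n) :
  shear_mx b (S + S') = shear_mx b S *m shear_mx b S'.
Proof.
by case: b; rewrite /shear_mx mulmx_block
  !(mul0mx, mulmx0, mul1mx, mulmx1, addr0, add0r) // addrC.
Qed.

Section LinearPaths.
Context (R : realType) (act : R -> R) (n : nat) (T : R).
Hypotheses (T_gt0 : 0 < T) (act_adm : admissible_activation act).
Local Notation real := (@realizable R act n T).

(** Realizability of the linear maps given by a path of matrices. *)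
Definition realizable_mx (F : R -> 'M[R]_(n + n)) := real (fun t z => F t *m z).

Lemma realizable_ext Psi Psi' :
  (forall t z, 0 <= t <= T -> Psi t z = Psi' t z) -> real Psi -> real Psi'.
Proof.
move=> E [[C C0 L] N]; split.
  exists C => // t tT; have [l b] := L t tT.
  by split=> [z z'|]; rewrite -!E.
move=> B e e0; have [m0 H] := N B e e0; exists m0 => m /H[s P]; exists s.
by move=> t z tT zB; rewrite -E // P.
Qed.

Lemma realizable_mx_ext F G : (forall t, 0 <= t <= T -> F t = G t) ->
  realizable_mx F -> realizable_mx G.
Proof. by move=> E; apply: realizable_ext => t z tT; rewrite E. Qed.

Lemma realizable_mxM F G : realizable_mx F -> realizable_mx G ->
  realizable_mx (fun t => F t *m G t).
Proof.
move=> rF rG; apply: realizable_ext (realizable_comp rF rG) => t z _.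
by rewrite mulmxA.
Qed.

Lemma realizable_mx1 : realizable_mx (fun=> 1%:M).
Proof.
apply: realizable_ext (realizable_id act n T) => t z _.
by rewrite mul1mx.
Qed.

Lemma realizable_shear_rank1 b (K : 'rV[R]_n) (alpha : R -> R) :
  continuous alpha -> realizable_mx (fun t => shear_mx b (alpha t *: (K^T *m K))).
Proof.
move=> ca; apply: realizable_ext (realizable_rank1 T_gt0 act_adm b K 0 ca).
move=> t z _; rewrite -{2}[z]vsubmxK /shear /shear_mx raddf0.
case: b; rewrite mul_block_col !(mul0mx, mul1mx, addr0, add0r).
  by rewrite -scalemxAl mulmxA addrC.
by rewrite -scalemxAl mulmxA addrC.
Qed.

Lemma realizable_shear_sum b (I : Type) (r : seq I) (S : I -> R -> 'M[R]_n) :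
  (forall i, realizable_mx (fun t => shear_mx b (S i t))) ->
  realizable_mx (fun t => shear_mx b (\sum_(i <- r) S i t)).
Proof.
move=> rS; elim: r => [|i r IH].
  apply: realizable_mx_ext realizable_mx1 => t _; rewrite big_nil /shear_mx.
  by case: b {rS}; rewrite -scalar_mx_block.
apply: realizable_mx_ext (realizable_mxM (rS i) IH) => t _.
by rewrite big_cons shear_mxD.
Qed.

(** Polarization: a symmetric matrix is a combination of rank one squares. *)
Lemma sym_polarization (S : 'M[R]_n) : S^T = S ->
  S = \sum_i \sum_j \sum_(p <- [:: (1, delta_mx 0 i + delta_mx 0 j);
     (-1, delta_mx 0 i); (-1, delta_mx 0 j)] : seq (R * 'rV[R]_n))
     (p.1 * (2^-1 * S i j)) *: (p.2^T *m p.2).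
Proof.
move=> symS.
have half : 2^-1 + 2^-1 = 1 :> R by field.
have E i j : \sum_(p <- [:: (1, delta_mx 0 i + delta_mx 0 j);
     (-1, delta_mx 0 i); (-1, delta_mx 0 j)] : seq (R * 'rV[R]_n))
     (p.1 * (2^-1 * S i j)) *: (p.2^T *m p.2) =
   2^-1 *: (S i j *: delta_mx i j) + 2^-1 *: (S j i *: delta_mx j i).
  have -> : S j i = S i j by rewrite -{1}symS mxE.
  rewrite !big_cons big_nil /= [(_ + _)^T]raddfD /= !trmx_delta mulmxDl !mulmxDr.
  rewrite !mul_delta_mx !mul1r !mulN1r !scaleNr !scalerDr !scalerA addr0.
  set a := _ *: delta_mx i i; set b := _ *: delta_mx i j.
  set c := _ *: delta_mx j i; set d := _ *: delta_mx j j.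
  by rewrite [a + b]addrC (addrACA b) -opprD addrK.
have D : \sum_i \sum_j 2^-1 *: (S i j *: delta_mx i j) = 2^-1 *: S.
  rewrite [in RHS](matrix_sum_delta S) scaler_sumr; apply: eq_bigr => i _.
  by rewrite scaler_sumr.
under eq_bigr do under eq_bigr do rewrite E.
under eq_bigr do rewrite big_split /=.
rewrite big_split /= [X in _ + X]exchange_big /=.
by rewrite !D -scalerDl half scale1r.
Qed.

Lemma realizable_shear b (S : R -> 'M[R]_n) : mx_continuous S ->
  (forall t, (S t)^T = S t) -> realizable_mx (fun t => shear_mx b (S t)).
Proof.
move=> cS symS.
under eq_fun do rewrite (sym_polarization (symS _)).
do 3!(apply: realizable_shear_sum => ?).
apply: realizable_shear_rank1 => t.
apply: cvgM; first exact: cvg_cst.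
by apply: cvgM; [exact: cvg_cst|exact: cS].
Qed.

Lemma realizable_translation (c : R -> 'cV[R]_(n + n)) : mx_continuous c ->
  real (fun t z => z + c t).
Proof.
move=> cc.
have single i : real (fun t z => z + c t i 0 *: delta_mx i 0).
  have ca : continuous (fun t => c t i 0) by exact: cc.
  have ca' : continuous (fun t => - c t i 0) by move=> t; apply: cvgN; exact: cc.
  (* two shears in opposite directions cancel except for the bias of the first *)
  have pair b k := realizable_comp
    (realizable_rank1 T_gt0 act_adm b (delta_mx 0 k : 'rV[R]_n) 1 ca)
    (realizable_rank1 T_gt0 act_adm b (delta_mx 0 k : 'rV[R]_n) 0 ca').
  case: (split_ordP i) => k ik.
    apply: realizable_ext (pair true k) => t z _.
    rewrite raddf0 -{2}[z]vsubmxK /shear !col_mxKu !col_mxKd trmx_delta.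
    rewrite addrA scaleNr addr0 mulmxDr scalerDr mulmx1.
    rewrite [_ + c t _ _ *: _]addrC addrK ik delta_mx_ushift.
    by rewrite scale_col_mx add_col_mx scaler0 addr0 addrC.
  apply: realizable_ext (pair false k) => t z _.
  rewrite raddf0 -{2}[z]vsubmxK /shear !col_mxKu !col_mxKd trmx_delta.
  rewrite scaleNr addr0 mulmxDr scalerDr mulmx1 -addrA addKr ik delta_mx_dshift.
  by rewrite scale_col_mx add_col_mx scaler0 addr0.
have sum (r : seq 'I_(n + n)) :
    real (fun t z => z + \sum_(i <- r) c t i 0 *: delta_mx i 0).
  elim: r => [|i r IH].
    apply: realizable_ext (realizable_id act n T) => t z _.
    by rewrite big_nil addr0.
  apply: realizable_ext (realizable_comp IH (single i)) => t z _.
  by rewrite big_cons addrA.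
apply: realizable_ext (sum (index_enum _)) => t z _; congr (_ + _).
rewrite [RHS]matrix_sum_delta; apply: eq_bigr => i _.
by rewrite big_ord_recl big_ord0 addr0.
Qed.

End LinearPaths.

(** * Symplectic matrices *)

(** [A] preserves the bilinear form of matrix [symplJ]. *)
Definition symplectic_mx (R : realType) (n : nat) (A : 'M[R]_(n + n)) :=
  A^T *m symplJ R n *m A = symplJ R n.

Section Symplectic.
Context (R : realType) (n : nat).
Implicit Types A B : 'M[R]_(n + n).

Lemma symplJ_sqr : symplJ R n *m symplJ R n = - 1%:M.
Proof.
rewrite mulmx_block !(mulmxN, mulNmx).
rewrite !(mul0mx, mulmx0, mul1mx, mulmx1, addr0, add0r, oppr0).
by rewrite [in RHS]scalar_mx_block opp_block_mx !oppr0.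
Qed.

Lemma symplectic_mxV A : symplectic_mx A ->
  - symplJ R n *m A^T *m symplJ R n *m A = 1%:M.
Proof.
by move=> sA; rewrite -!mulmxA mulNmx (mulmxA A^T) sA symplJ_sqr opprK.
Qed.

Lemma symplectic_mx_unit A : symplectic_mx A -> A \in unitmx.
Proof. by move=> /symplectic_mxV /mulmx1_unit[]. Qed.

Lemma symplectic_mxM A B : symplectic_mx A -> symplectic_mx B ->
  symplectic_mx (A *m B).
Proof.
rewrite /symplectic_mx => sA sB.
by rewrite trmx_mul !mulmxA -(mulmxA B^T) -(mulmxA B^T) sA.
Qed.

Lemma symplectic_mx_inv A : symplectic_mx A -> symplectic_mx (invmx A).
Proof.
move=> sA; have uA := symplectic_mx_unit sA; rewrite /symplectic_mx -{1}sA.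
by rewrite trmx_inv !mulmxA mulVmx ?unitmx_tr // mul1mx mulmxK.
Qed.

Lemma symplectic_shear b (S : 'M[R]_n) : S^T = S -> symplectic_mx (shear_mx b S).
Proof.
move=> sS; rewrite /symplectic_mx; case: b;
rewrite /shear_mx tr_block_mx !trmx0 !trmx1 sS !mulmx_block !(mulmxN, mulNmx)
  !(mul0mx, mulmx0, mul1mx, mulmx1, addr0, add0r, oppr0)
  ?mulNmx ?mul1mx ?addNr ?addrN //.
Qed.

Lemma symplectic_blocks A : symplectic_mx A ->
  [/\ (ulsubmx A)^T *m dlsubmx A = (dlsubmx A)^T *m ulsubmx A,
      (ulsubmx A)^T *m drsubmx A - (dlsubmx A)^T *m ursubmx A = 1%:M &
      (ursubmx A)^T *m drsubmx A = (drsubmx A)^T *m ursubmx A].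
Proof.
rewrite /symplectic_mx -{1 2}[A]submxK tr_block_mx !mulmx_block.
rewrite !(mulmxN, mulNmx) !(mulmx0, mulmx1, addr0, add0r, oppr0) !mulNmx.
move=> /eq_block_mx[E1 E2 _ E4]; split.
- by apply/eqP; rewrite -subr_eq0 addrC E1.
- by rewrite addrC E2.
- by apply/eqP; rewrite -subr_eq0 addrC E4.
Qed.

(** A symplectic matrix whose upper left block [P] is invertible is the product of
    a lower shear, [diag(P, P^-T)] and an upper shear, both with symmetric
    matrices. *)
Lemma symplectic_LDU A : symplectic_mx A -> ulsubmx A \in unitmx ->
  let Y := dlsubmx A *m invmx (ulsubmx A) in
  let X := invmx (ulsubmx A) *m ursubmx A in
  [/\ Y^T = Y, X^T = X & A = shear_mx false Y *m
    block_mx (ulsubmx A) 0 0 (invmx (ulsubmx A)^T) *m shear_mx true X].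
Proof.
move=> /symplectic_blocks.
set P := ulsubmx A; set Q := ursubmx A; set L := dlsubmx A; set S := drsubmx A.
move=> [E1 E2 E3] uP Y X; have uPT : P^T \in unitmx by rewrite unitmx_tr.
have YP : Y *m P = L by rewrite /Y mulmxKV.
have PX : P *m X = Q by rewrite /X mulKVmx.
have symY : Y^T = Y.
  apply: (can_inj (mulmxK uP)); apply: (can_inj (mulKmx uPT)).
  by rewrite YP E1 mulmxA -trmx_mul YP.
have SE : S = Y *m Q + invmx P^T.
  apply: (can_inj (mulKmx uPT)); rewrite mulmxDr mulmxV // mulmxA.
  by rewrite -{1}symY -trmx_mul YP -E2 addrC subrK.
have symX : X^T = X.
  have XT : X^T = Q^T *m invmx P^T by rewrite /X trmx_mul trmx_inv.
  move: E3; rewrite SE mulmxDr [(_ + _)^T]raddfD /= mulmxDl trmx_mul symY mulmxA.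
  by move/addrI; rewrite -XT trmx_inv trmxK.
split=> //; rewrite /shear_mx !mulmx_block.
rewrite !(mul0mx, mulmx0, mul1mx, mulmx1, addr0, add0r) YP PX.
rewrite -{1}[A]submxK; congr block_mx.
by rewrite -/S SE -YP -mulmxA PX.
Qed.

(** Let [P] and [L] be the left blocks of [A].  If [P + i L] had a kernel vector
    [v i] for each [i <= n], the [n + 1] vectors [L v i] of R^n would be nonzero,
    because [A] is invertible, and pairwise orthogonal, because [P^T L] is
    symmetric. *)
Lemma symplectic_unit_pencil A : symplectic_mx A ->
  exists i : nat, ulsubmx A + i%:R *: dlsubmx A \in unitmx.
Proof.
move=> sA; have uA := symplectic_mx_unit sA.
have [E1 _ _] := symplectic_blocks sA; move: E1.
set P := ulsubmx A; set L := dlsubmx A => E1.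
apply: contrapT => H.
have ker (i : 'I_n.+1) : exists v : 'cV[R]_n, v != 0 /\ (P + i%:R *: L) *m v = 0.
  have /det0P[v v0 vE] : \det (P + (i : nat)%:R *: L)^T == 0.
    rewrite det_tr; apply: contraT => d; exfalso; apply: H; exists i.
    by rewrite unitmxE unitfE.
  exists v^T; rewrite -trmx_eq0 trmxK v0; split => //.
  by apply: trmx_inj; rewrite trmx_mul trmxK vE trmx0.
have {ker}[v vP] : {v : 'I_n.+1 -> 'cV[R]_n |
    forall i, v i != 0 /\ (P + (i : nat)%:R *: L) *m v i = 0}.
  by exists (fun i => projT1 (cid (ker i))) => i; exact: (projT2 (cid (ker i))).
have Pv i : P *m v i = - ((i : nat)%:R *: (L *m v i)).
  have [_ /eqP] := vP i; rewrite mulmxDl addr_eq0 => /eqP ->.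
  by rewrite scalemxAl.
have Lv i : L *m v i != 0.
  apply/eqP => L0; have [/eqP v0 _] := vP i; apply: v0.
  have : A *m col_mx (v i) 0 = 0.
    rewrite -[A]submxK mul_block_col !mulmx0 !addr0 -/P -/L Pv L0 scaler0 oppr0.
    by rewrite col_mx0.
  move=> /(congr1 (mulmx (invmx A))); rewrite mulKmx // mulmx0.
  by move=> /(congr1 usubmx); rewrite col_mxKu linear0.
pose W : 'M[R]_(n.+1, n) := \matrix_(i, k) (L *m v i) k 0.
have WE i j : (W *m W^T) i j = ((L *m v i)^T *m (L *m v j)) 0 0.
  by rewrite !mxE; apply: eq_bigr => k _; rewrite !mxE.
have off i j : i != j -> (W *m W^T) i j = 0.
  move=> ij; rewrite WE.
  have e1 : (P *m v i)^T *m (L *m v j) = (L *m v i)^T *m (P *m v j).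
    by rewrite !trmx_mul -!mulmxA (mulmxA P^T) E1 -mulmxA.
  move: e1; rewrite !Pv [(- _)^T]raddfN /= linearZ /= mulNmx mulmxN.
  rewrite -scalemxAl -scalemxAr.
  move/oppr_inj/matrixP/(_ 0 0); rewrite [LHS]mxE [RHS]mxE => /eqP.
  rewrite -subr_eq0 -mulrBl mulf_eq0 subr_eq0 eqr_nat => /orP[/eqP e|/eqP //].
  by case/eqP: ij; exact: val_inj.
have dia i : (W *m W^T) i i != 0.
  rewrite WE mxE psumr_neq0 => [|k _]; last by rewrite !mxE -expr2 sqr_ge0.
  apply/hasP; apply: contrapT => nh; case/eqP: (Lv i); apply/matrixP => k l.
  rewrite ord1 [RHS]mxE; apply/eqP; apply: contraT => Lk; exfalso; apply: nh.
  exists k; first exact: mem_index_enum.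
  by rewrite /= mxE -expr2 exprn_even_gt0.
have uW : W *m W^T \in unitmx.
  rewrite unitmxE det_trig; last first.
    by apply/is_trig_mxP => i j ij; apply: off; rewrite neq_ltn ij.
  by rewrite unitfE; apply/prodf_neq0 => i _.
have := mxrank_unit uW; have := mxrankM_maxl W W^T; have := rank_leq_col W.
by move=> h1 h2 h3; have := leq_trans h2 h1; rewrite h3 ltnn.
Qed.

End Symplectic.

(** * Symplectic paths *)

Lemma invmx_mul (R : realType) n (A B : 'M[R]_n) :
  A \in unitmx -> B \in unitmx -> invmx (A *m B) = invmx B *m invmx A.
Proof.
move=> uA uB; have uAB : A *m B \in unitmx by rewrite unitmx_mul uA.
apply: (can_inj (mulKmx uAB)).
by rewrite mulmxV // mulmxA mulmxK // mulmxV.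
Qed.

Section SymplecticPaths.
Context (R : realType) (act : R -> R) (n : nat) (T : R).
Hypotheses (T_gt0 : 0 < T) (act_adm : admissible_activation act).
Local Notation realmx := (@realizable_mx R act n T).

(** [diag(Q, Q^-1)] is the product of two quarter turns, each of which is a
    product of three shears. *)
Lemma realizable_diag (P : R -> 'M[R]_n) : sym_product P ->
  realmx (fun t => block_mx (P t) 0 0 (invmx (P t)^T)).
Proof.
elim=> {P} [Q cQ sQ uQ|P Q sP IHP sQ IHQ]; last first.
  apply: realizable_mx_ext (realizable_mxM IHP IHQ) => t _.
  rewrite mulmx_block !(mul0mx, mulmx0, addr0, add0r); congr block_mx.
  by rewrite trmx_mul invmx_mul ?unitmx_tr ?sym_product_unit.
pose rot (S : R -> 'M[R]_n) t : 'M[R]_(n + n) := block_mx 0 (S t) (- invmx (S t)) 0.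
have rrot (S : R -> 'M[R]_n) : mx_continuous S -> (forall t, (S t)^T = S t) ->
    (forall t, S t \in unitmx) -> realmx (rot S).
  move=> cS sS uS.
  have up := realizable_shear T_gt0 act_adm true cS sS.
  have lo := realizable_shear T_gt0 act_adm false
    (mx_continuousN (mx_continuousV cS uS)).
  apply: realizable_mx_ext (realizable_mxM (realizable_mxM up (lo _)) up).
    move=> t _; rewrite /shear_mx /rot !mulmx_block.
    rewrite !(mul0mx, mulmx0, mul1mx, mulmx1, addr0, add0r) mulmxN mulmxV //.
    by rewrite subrr mul0mx add0r mulNmx mulVmx // addNr.
  by move=> t; rewrite raddfN /= trmx_inv sS.
have c1 : mx_continuous (fun=> - 1%:M : 'M[R]_n) by exact: mx_continuous_cst.
have uN1 : - 1%:M \in @unitmx R n by rewrite -scaleN1r unitmxZ ?unitmx1 // unitrN1.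
have V1 : invmx (- 1%:M : 'M[R]_n) = - 1%:M.
  by apply: (can_inj (mulKmx uN1)); rewrite mulmxV // mulmxN mulmx1 opprK.
apply: realizable_mx_ext (realizable_mxM (rrot Q cQ sQ uQ) (rrot _ c1 _ _)).
- move=> t _; rewrite /rot mulmx_block V1 sQ !(mul0mx, mulmx0, addr0, add0r).
  by rewrite opprK mulmx1 mulNmx mulmxN mulmx1 opprK.
- by move=> t; rewrite raddfN /= trmx1.
- by [].
Qed.

Lemma realizable_symplectic_pivot (A : R -> 'M[R]_(n + n)) : mx_continuous A ->
  (forall t, symplectic_mx (A t)) -> sym_product (fun t => ulsubmx (A t)) ->
  realmx A.
Proof.
move=> cA sA spA; have uA := sym_product_unit spA.
pose Y t := dlsubmx (A t) *m invmx (ulsubmx (A t)).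
pose X t := invmx (ulsubmx (A t)) *m ursubmx (A t).
have LDU t := symplectic_LDU (sA t) (uA t).
have cV : mx_continuous (fun t => invmx (ulsubmx (A t))).
  by apply: mx_continuousV => //; exact: mx_continuous_ulsub.
have rY : realmx (fun t => shear_mx false (Y t)).
  apply: realizable_shear => // [|t]; last by have [] := LDU t.
  by apply: mx_continuousM => //; exact: mx_continuous_dlsub.
have rX : realmx (fun t => shear_mx true (X t)).
  apply: realizable_shear => // [|t]; last by have [] := LDU t.
  by apply: mx_continuousM => //; exact: mx_continuous_ursub.
have := realizable_mxM (realizable_mxM rY (realizable_diag spA)) rX.
by apply: realizable_mx_ext => t _; have [_ _ <-] := LDU t.
Qed.

(** A shear makes the upper left block invertible. *)
Lemma realizable_symplectic_cst (A : 'M[R]_(n + n)) : symplectic_mx A ->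
  realmx (fun=> A).
Proof.
move=> sA; have [i ui] := symplectic_unit_pencil sA.
pose S : 'M[R]_n := i%:R%:M; have symS : S^T = S by exact: tr_scalar_mx.
have symNS : (- S)^T = - S by rewrite raddfN /= symS.
have cS := @mx_continuous_cst R n n.
have sSA : symplectic_mx (shear_mx true S *m A).
  by apply: symplectic_mxM => //; exact: symplectic_shear.
have ul : ulsubmx (shear_mx true S *m A) = ulsubmx A + i%:R *: dlsubmx A.
  rewrite -{1}[A]submxK /shear_mx mulmx_block block_mxKul mul1mx.
  by rewrite mul_scalar_mx.
have rSA : realmx (fun=> shear_mx true S *m A).
  apply: realizable_symplectic_pivot => //; first exact: mx_continuous_cst.
  by apply: sym_product_cst; rewrite ul.
have rS : realmx (fun=> shear_mx true (- S)) by exact: realizable_shear.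
apply: realizable_mx_ext (realizable_mxM rS rSA) => t _.
rewrite mulmxA -shear_mxD addNr /shear_mx.
by rewrite -scalar_mx_block mul1mx.
Qed.

Lemma sum_sqr_gt0 (v : 'cV[R]_n) : v != 0 -> 0 < \sum_i v i 0 ^+ 2.
Proof.
move=> v0; rewrite lt0r sumr_ge0 ?andbT => [|i _]; last exact: sqr_ge0.
apply: contra v0; rewrite psumr_eq0 => [/allP H|i _]; last exact: sqr_ge0.
apply/eqP/matrixP => i j; rewrite ord1 mxE; apply/eqP.
by have := H i (mem_index_enum _); rewrite sqrf_eq0.
Qed.

(** Matrices near the identity have a positive quadratic form. *)
Lemma pos_near_id (P : 'M[R]_n) (d : R) : n%:R * d < 1 ->
  (forall i j, `|P i j - (1%:M : 'M[R]_n) i j| <= d) ->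
  forall v : 'cV_n, v != 0 -> 0 < (v^T *m P *m v) 0 0.
Proof.
move=> nd Pd v v0; pose s := \sum_i v i 0 ^+ 2.
have s0 : 0 < s by exact: sum_sqr_gt0.
pose E := P - 1%:M.
have -> : P = E + 1%:M by rewrite subrK.
rewrite mulmxDr mulmx1 mulmxDl mxE.
have -> : (v^T *m v) 0 0 = s.
  by rewrite mxE; apply: eq_bigr => i _; rewrite mxE expr2.
suff: `|(v^T *m E *m v) 0 0| <= n%:R * d * s.
  rewrite ler_norml => /andP[h _].
  have : n%:R * d * s < s by rewrite gtr_pMl.
  by move: h; set a := (_ *m v) 0 0; lra.
have -> : (v^T *m E *m v) 0 0 = \sum_j \sum_i v i 0 * E i j * v j 0.
  rewrite mxE; apply: eq_bigr => j _; rewrite mxE mulr_suml.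
  by apply: eq_bigr => i _; rewrite mxE.
have -> : n%:R * d * s =
    \sum_(j < n) \sum_(i < n) d * (2^-1 * (v i 0 ^+ 2 + v j 0 ^+ 2)).
  have -> : \sum_(j < n) \sum_(i < n) d * (2^-1 * (v i 0 ^+ 2 + v j 0 ^+ 2)) =
      \sum_(j < n) d * (2^-1 * (s + n%:R * v j 0 ^+ 2)).
    apply: eq_bigr => j _; rewrite -!mulr_sumr big_split /= sumr_const card_ord.
    by rewrite mulr_natl.
  rewrite -!mulr_sumr big_split /= sumr_const card_ord -mulr_sumr -/s.
  by rewrite -mulr_natl; field.
apply: le_trans (ler_norm_sum _ _ _) _; apply: ler_sum => j _.
apply: le_trans (ler_norm_sum _ _ _) _; apply: ler_sum => i _.
have Ed : `|E i j| <= d by have := Pd i j; rewrite /E !mxE.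
rewrite mulrAC normrM mulrC ler_pM // normrM.
rewrite -(real_normK (num_real (v i 0))) -(real_normK (num_real (v j 0))).
set a := `|v i 0|; set b := `|v j 0|.
have := sqr_ge0 (a - b); nra.
Qed.

(** Cut [0, T] into pieces on which the path moves little: the path frozen after
    the first [k.+1] pieces is the path frozen after the first [k] ones times a
    path near the identity. *)
Theorem realizable_symplectic (A : R -> 'M[R]_(n + n)) : mx_continuous A ->
  (forall t, symplectic_mx (A t)) -> realmx A.
Proof.
move=> cA sA.
have uA t : A t \in unitmx by exact: symplectic_mx_unit.
have cV := mx_continuousV cA uA.
have [C C0 CP] := mx_continuous_bounded (ltW T_gt0) cV.
pose K : R := (n + n)%:R * C + 1.
have K0 : 0 < K by rewrite ltr_wpDl // mulr_ge0.
pose e : R := n.+1%:R^-1 / K.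
have e0 : 0 < e by rewrite divr_gt0 // invr_gt0.
have [d [d0 dP]] : exists d, 0 < d /\ forall x y, 0 <= x <= T -> `|y - x| <= d ->
    `|A y - A x| <= e.
  have near_d : \forall d \near 0^'+, forall ij : 'I_(n + n) * 'I_(n + n),
      forall x y, 0 <= x <= T -> `|y - x| <= d ->
      `|A y ij.1 ij.2 - A x ij.1 ij.2| <= e.
    by apply: filter_forall => ij; apply: heine.
  have [d [d0 dP]] := filter_ex (filterI (nbhs_right_gt 0) near_d).
  exists d; split => // x y xT yx; apply: mx_norm_ler => [|i j]; first exact: ltW.
  by have := dP (i, j) x y xT yx; rewrite !mxE.
have near_id x y : 0 <= x <= T -> `|y - x| <= d ->
    forall i j, `|(invmx (A x) *m A y - 1%:M) i j| <= n.+1%:R^-1.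
  move=> xT yx i j; apply: le_trans (ler_entry_mx_norm _ _ _) _.
  rewrite -(mulVmx (uA x)) -mulmxBr; apply: le_trans (ler_norm_mulmx _ _) _.
  apply: (@le_trans _ _ ((n + n)%:R * C * e)).
    by rewrite ler_pM ?mulr_ge0 ?dP // ler_wpM2l // CP.
  by rewrite /e mulrCA ler_piMr ?invr_ge0 // ler_pdivrMr // mul1r lerDl.
pose N := (Num.truncn (T / d)).+1.
pose del := T / N%:R.
have N0 : 0 < N%:R :> R by rewrite ltr0n.
have del0 : 0 <= del by rewrite divr_ge0 // ltW.
have deld : del <= d.
  by rewrite ler_pdivrMr // mulrC -ler_pdivrMr // ltW // truncnS_gt.
have NT : N%:R * del = T by rewrite mulrC divfK // gt_eqF.
have cmin (c : R) : continuous (fun t => Num.min t c).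
  move=> t; apply: (@continuous_min R R id (fun=> c)); first exact: cvg_id.
  exact: cvg_cst.
have cAmin c : mx_continuous (fun t => A (Num.min t c)).
  move=> i j t.
  apply: (@continuous_comp _ _ _ (fun t => Num.min t c) (fun s => A s i j)).
    exact: cmin.
  exact: cA.
have main k : (k <= N)%N -> realmx (fun t => A (Num.min t (k%:R * del))).
  elim: k => [_|k IH kN].
    apply: realizable_mx_ext (realizable_symplectic_cst (sA 0)) => t /andP[t0 _].
    by rewrite mul0r min_r.
  pose x t := Num.min t (k%:R * del); pose y t := Num.min t (k.+1%:R * del).
  have kk : k.+1%:R * del = k%:R * del + del by rewrite -natr1 mulrDl mul1r.
  have kT : k%:R * del + del <= T by rewrite -kk -NT ler_wpM2r // ler_nat.
  have kd0 : 0 <= k%:R * del by rewrite mulr_ge0.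
  have cB : mx_continuous (fun t => invmx (A (x t)) *m A (y t)).
    apply: mx_continuousM; last exact: cAmin.
    by apply: mx_continuousV => //; exact: cAmin.
  have rB : realmx (fun t => invmx (A (x t)) *m A (y t)).
    apply: realizable_symplectic_pivot => [|t|].
    - exact: cB.
    - by apply: symplectic_mxM => //; exact: symplectic_mx_inv.
    apply: sym_product_pos => [|t].
      exact: mx_continuous_ulsub.
    apply: (@pos_near_id _ n.+1%:R^-1).
      by rewrite ltr_pdivrMr // mul1r ltr_nat.
    move=> i j.
    have -> : ulsubmx (invmx (A (x t)) *m A (y t)) i j - (1%:M : 'M[R]_n) i j =
        (invmx (A (x t)) *m A (y t) - 1%:M) (lshift n i) (lshift n j).
      by rewrite !mxE (inj_eq (@lshift_inj _ _)).
    have [tk|tk] := leP t (k%:R * del).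
      rewrite /x /y min_l // min_l; last by rewrite kk (le_trans tk) // lerDl.
      by rewrite mulVmx // subrr mxE normr0 invr_ge0.
    have xE : x t = k%:R * del by rewrite /x min_r // ltW.
    apply: near_id; rewrite xE; first by rewrite kd0 /= (le_trans _ kT) // lerDl.
    have h1 : k%:R * del <= y t by rewrite /y le_min (ltW tk) kk lerDl.
    have h2 : y t <= k%:R * del + del by rewrite /y kk ge_min lexx orbT.
    by rewrite ger0_norm ?subr_ge0 // lerBlDl (le_trans h2) // lerD2l.
  apply: realizable_mx_ext (realizable_mxM (IH (ltnW kN)) rB) => t _.
  by rewrite mulKVmx.
apply: realizable_mx_ext (main N (leqnn N)) => t /andP[_ tT].
by rewrite NT min_l.
Qed.

End SymplecticPaths.

(** * Affine symplectic families *)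

Lemma realizable_sympnet (R : realType) (act : R -> R) n (T : R) Psi (B e : R) :
  @realizable R act n T Psi -> 0 < e ->
  exists2 psi, is_tl_sympnet act psi &
    forall t z, 0 <= t <= T -> `|z| <= B -> `|psi t z - Psi t z| <= e.
Proof.
move=> [_ N] e0; have [m0 H] := N B e e0.
have [s sP] := H _ (leqnSn m0).
(* an idle layer makes the number of layers positive *)
pose u0 := unit_of (0 : 'rV[R]_n) 0 m0.+1 [::].
exists (tl_net_up_low act (in_tuple ((u0, u0) :: s))).
  exists (size s).+1, 1%N, 0%N, m0.+1, (in_tuple ((u0, u0) :: s)).
  by split => //; left.
move=> t z tT zB; rewrite /tl_net_up_low /= /tl_up /tl_low /=.
have u0E x : tl_sigma act u0 x t = 0 by rewrite unit_ofE // trmx0 mul0mx scaler0.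
by rewrite !u0E add0r addr0 !vsubmxK; exact: sP.
Qed.

Lemma enorm_ler (R : realType) m (v : 'cV[R]_m) : enorm v <= m%:R * `|v|.
Proof.
rewrite /enorm -(ler_pXn2r (n := 2)) ?nnegrE ?sqrtr_ge0 ?mulr_ge0 //.
rewrite sqr_sqrtr; last by apply: sumr_ge0 => i _; exact: sqr_ge0.
apply: (@le_trans _ _ (\sum_(i < m) `|v| ^+ 2)).
  apply: ler_sum => i _; rewrite -real_normK ?num_real //.
  by rewrite lerXn2r ?nnegrE // ler_entry_mx_norm.
rewrite sumr_const card_ord exprMn -[leLHS]mulr_natl ler_wpM2r ?sqr_ge0 //.
by case: m v => [|m] v; rewrite ?expr0n // expr2 ler_peMl // ler1n.
Qed.

(** The projection of the time axis onto [0, T]; it extends paths defined on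
    [0, T] to all times. *)
Definition clamp (R : realType) (T t : R) := Num.max 0 (Num.min t T).

Lemma clamp_itv (R : realType) (T t : R) : 0 <= T -> 0 <= clamp T t <= T.
Proof. by move=> T0; rewrite le_max lexx ge_max T0 ge_min lexx orbT. Qed.

Lemma clamp_id (R : realType) (T t : R) : 0 <= t <= T -> clamp T t = t.
Proof. by move=> /andP[t0 tT]; rewrite /clamp (min_l tT) max_r. Qed.

Lemma continuous_clamp (R : realType) (T : R) : continuous (clamp T).
Proof.
move=> t; apply: (@continuous_max R R (fun=> 0) (fun t => Num.min t T)).
  exact: cvg_cst.
by apply: (@continuous_min R R id (fun=> T)); [exact: cvg_id|exact: cvg_cst].
Qed.

Lemma grad_affine (R : realType) m k (f : 'cV[R]_m -> 'cV[R]_k)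
    (U : set 'cV[R]_m) (A : 'M[R]_(k, m)) (c : 'cV[R]_k) z :
  open U -> U z -> (forall y, U y -> f y = A *m y + c) -> grad f z = A.
Proof.
move=> oU Uz fE; apply/matrixP => i j; rewrite mxE.
have fg : \forall y \near z, f y = A *m y + c.
  by apply: filterS (open_nbhs_nbhs (conj oU Uz)) => y; exact: fE.
rewrite (near_eq_derive _ fg).
suff -> : 'D_(delta_mx j 0) (fun y => A *m y + c) z = A *m delta_mx j 0.
  by rewrite -colE mxE.
apply: lim_near_cst; first exact: norm_hausdorff.
near=> h; have h0 : h != 0 by near: h; exact: nbhs_dnbhs_neq.
rewrite /=.
rewrite opprD addrACA subrr addr0 mulmxDr addrK -scalemxAr scalerA mulVf // scale1r.
by [].
Unshelve. all: by end_near.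
Qed.

(** Only the time direction of the derivative is used: increments in that
    direction are multiples of the fixed vector (0, 1). *)
Lemma C1_on_continuous_time (R : realType) m k (T : R) (U : set 'cV[R]_m)
    (phi : 'cV[R]_m -> R -> 'cV[R]_k) : 0 <= T ->
  C1_on (U `*` `[0, T]) (fun zt : 'cV[R]_m * R => phi zt.1 zt.2) ->
  forall z, U z -> mx_continuous (fun t => phi z (clamp T t)).
Proof.
move=> T0 [Df [dP _]] z Uz i j t.
pose s := clamp T t; pose p : 'cV[R]_m * R := (z, s).
have Sp u : (U `*` `[0, T]) (z, clamp T u).
  by split => //=; rewrite in_itv /=; exact: clamp_itv.
have := dP p (Sp t) 1 ltr01.
pose w : 'cV[R]_m * R := (0, 1).
pose K := `|Df p w| + `|w|; have K0 : 0 < K + 1 by rewrite ltr_wpDl // addr_ge0.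
move=> near_p; apply/cvgrPdist_le => e e0.
have cp : (fun u => (z, clamp T u)) @ t --> p.
  apply: (@cvg_pair _ _ _ (nbhs t) (nbhs z) (nbhs s)); first exact: cvg_cst.
  exact: (@continuous_clamp R T t).
have := cp _ near_p.
have /cvgrPdist_le /(_ (e / (K + 1))) := @continuous_clamp R T t.
rewrite divr_gt0 // => /(_ isT).
apply: filterS2 => u hu /(_ (Sp u)) /=.
have -> : (z, clamp T u) - p = (clamp T u - s) *: w.
  by congr (_, _); rewrite /= ?subrr ?scaler0 //; exact: esym (mulr1 _).
rewrite linearZ /= normrZ mul1r => hp.
rewrite -/s distrC.
apply: (@le_trans _ _ `|phi z (clamp T u) - phi z s|).
  by have := ler_entry_mx_norm (phi z (clamp T u) - phi z s) i j; rewrite !mxE.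
rewrite -(subrK ((clamp T u - s) *: Df p w) (phi z _ - _)).
apply: le_trans (ler_normD _ _) _; rewrite normrZ.
apply: (@le_trans _ _ (`|clamp T u - s| * K)).
  by rewrite /K mulrDr addrC lerD2l.
rewrite distrC in hu; apply: (@le_trans _ _ (e / (K + 1) * K)).
  by rewrite ler_wpM2r // addr_ge0.
by rewrite mulrAC ler_pdivrMr // ler_wpM2l ?(ltW e0) // lerDl.
Qed.

(** The coefficients of an affine time-dependent symplectic map on a nonempty
    open set, extended to all times by
    freezing them outside [0, T]. *)
Lemma affine_symplectic_coefficients (R : realType) n (T : R)
    (U : set 'cV[R]_(n + n)) phi z0 : 0 <= T -> open U -> U z0 ->
  affine_time_dependent_symplectic T U phi ->
  exists A c, [/\ mx_continuous A, forall t, symplectic_mx (A t), mx_continuous c &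
    forall t z, 0 <= t <= T -> U z -> phi z t = A t *m z + c t].
Proof.
move=> T0 oU Uz0 [[hC1 hsym] haff].
have ex t : exists Ac : 'M[R]_(n + n) * 'cV[R]_(n + n),
    0 <= t <= T -> forall z, U z -> phi z t = Ac.1 *m z + Ac.2.
  have [tT|_] := boolP (0 <= t <= T); last by exists (0, 0).
  by have [|A [c H]] := haff t; [rewrite in_itv|exists (A, c)].
have [Ac AcP] := choice ex.
pose A t := (Ac (clamp T t)).1; pose c t := (Ac (clamp T t)).2.
have phiE t z : U z -> phi z (clamp T t) = A t *m z + c t.
  by apply: AcP; exact: clamp_itv.
have cphi z : U z -> mx_continuous (fun t => phi z (clamp T t)).
  exact: C1_on_continuous_time.
have cA : mx_continuous A.
  have /nbhs_ballP[r /= r0 rU] := open_nbhs_nbhs (conj oU Uz0).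
  have r2 : 0 < r / 2 by rewrite divr_gt0.
  move=> i j.
  (* [A] is read off from the images of [z0] and of nearby points of [U] *)
  pose y := z0 + (r / 2) *: delta_mx j 0.
  have Uy : U y.
    apply: rU; rewrite -ball_normE /= /y opprD addrA subrr sub0r normrN normrZ.
    rewrite (gtr0_norm r2); apply: (@le_lt_trans _ _ (r / 2)); last by lra.
    rewrite ler_piMr ?(ltW r2) //; apply: mx_norm_ler => // k l.
    by rewrite mxE; case: (_ && _); rewrite ?normr1 ?normr0.
  have AE : (fun t => A t i j) =
      (fun t => (r / 2)^-1 * (phi y (clamp T t) i 0 - phi z0 (clamp T t) i 0)).
    apply: funext => t; rewrite !phiE // /y mulmxDr.
    have -> : A t i j = (A t *m (delta_mx j 0 : 'cV[R]_(n + n))) i 0.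
      by rewrite -colE mxE.
    by rewrite -scalemxAr !mxE; field; rewrite gt_eqF.
  rewrite AE => t; apply: cvgM; first exact: cvg_cst.
  by apply: cvgB; exact: cphi.
exists A, c; split => //.
- move=> t; have tT := clamp_itv t T0.
  have := hsym (clamp T t); rewrite in_itv /= tT => /(_ isT z0 Uz0).
  by rewrite (grad_affine oU Uz0 (AcP _ tT)).
- have -> : c = (fun t => phi z0 (clamp T t) - A t *m z0).
    by apply: funext => t; rewrite phiE // addrC addKr.
  apply: mx_continuousD; first exact: cphi.
  apply: mx_continuousN; apply: mx_continuousM => //; exact: mx_continuous_cst.
- by move=> t z tT Uz; rewrite -phiE // clamp_id.
Qed.

Unset Implicit Arguments.

Theorem theorem3p4 (R : realType) (act : R -> R) (n : nat) (T : R)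
    (hact : admissible_activation act) (hn : (0 < n)%N) (hT : 0 < T)
    (U : set 'cV[R]_(n + n)) (hU : open U)
    (phi : 'cV[R]_(n + n) -> R -> 'cV[R]_(n + n))
    (hphi : affine_time_dependent_symplectic T U phi)
    (W : set 'cV[R]_(n + n)) (hW : compact W) (hWU : W `<=` U)
    (eps : R) (heps : 0 < eps) :
  exists psi : R -> 'cV[R]_(n + n) -> 'cV[R]_(n + n),
    is_tl_sympnet act psi /\
    (ereal_sup [set ereal_sup [set (enorm (psi t z - phi z t))%:E | z in W]
               | t in `[0%R, T]] < eps%:E)%E.
Proof.
have [Psi rPsi PsiE] : exists2 Psi, @realizable R act n T Psi &
    forall t z, 0 <= t <= T -> W z -> phi z t = Psi t z.
  have [[z0 Wz0]|W0] := pselect (exists z, W z); last first.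
    exists (fun=> id); first exact: realizable_id.
    by move=> t z _ Wz; case: W0; exists z.
  have [A [c [cA sA cc phiE]]] :=
    affine_symplectic_coefficients (ltW hT) hU (hWU _ Wz0) hphi.
  exists (fun t z => A t *m z + c t); last by move=> t z tT /hWU; exact: phiE.
  exact: (realizable_comp (realizable_translation hT hact cc)
    (realizable_symplectic hT hact cA sA)).
have [B WB] : exists B, forall z, W z -> `|z| <= B.
  have [B [_ WB]] := compact_bounded hW.
  by exists (B + 1) => z; apply: WB; rewrite ltrDl.
(* the Euclidean norm is at most [n + n] times the sup norm, and the supremum
   must stay strictly below [eps] *)
pose K : R := 2 * ((n + n)%:R + 1).
have K0 : 0 < K by rewrite mulr_gt0 // ltr_wpDl.
have [psi netpsi psiP] := realizable_sympnet B rPsi (divr_gt0 heps K0).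
exists psi; split => //.
apply: (@le_lt_trans _ _ (eps / 2)%:E); last first.
  by rewrite lte_fin ltr_pdivrMr // ltr_pMr // ltr1n.
apply: ub_ereal_sup => _ [t tT <-]; apply: ub_ereal_sup => _ [z Wz <-].
rewrite /= in_itv /= in tT.
rewrite lee_fin (PsiE t z tT Wz); apply: le_trans (enorm_ler _) _.
apply: (@le_trans _ _ ((n + n)%:R * (eps / K))).
  by rewrite ler_wpM2l // psiP // WB.
rewrite /K; set d : R := (n + n)%:R; have d0 : 0 <= d by exact: ler0n.
have -> : d * (eps / (2 * (d + 1))) = eps / 2 * (d / (d + 1)).
  by field; rewrite gt_eqF // ltr_wpDl.
by rewrite ler_piMr ?divr_ge0 ?(ltW heps) // ler_pdivrMr ?ltr_wpDl // mul1r lerDl.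
Qed.
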